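(* Let $d\ge1$ and let $f:\mathbb{T}^d\to[0,1]$ be measurable, not a.e. equal to $0$ and not a.e. equal to $1$. The following are equivalent: (i) $(\mathbb{P}^f)^+=\mathbb{P}^f$; (ii) $f$ is in the closure in $L^2(1/f)$ of $\mathcal{T}\cap L^2(1/f)$; (iii) there exists a nonzero trigonometric polynomial $T$ such that $\frac{|T|^2}{f}\in L^1(\mathbb{T}^d)$; i.e., $\mathcal{T}\cap L^2(1/f)\ne\{0\}$. Moreover, if $(\mathbb{P}^f)^+\neq\mathbb{P}^f$, then $(\mathbb{P}^f)^+=\delta_{\mathbf 0}$.
   Context: $\mathbb{T}^d:=\mathbb{R}^d/\mathbb{Z}^d$ with unit Lebesgue measure $\lambda_d$; $\widehat f(k):=\int_{\mathbb{T}^d} f(x)e^{-2\pi i k\cdot x}\,d\lambda_d(x)$. For measurable $f:\mathbb{T}^d\to[0,1]$, $\mathbb{P}^f$ is the unique Borel probability measure on $\{0,1\}^{\mathbb{Z}^d}$ such that for all $k\ge1$ and all distinct $e_1,\dots,e_k\in\mathbb{Z}^d$, $\mathbb{P}^f[\eta(e_1)=1,\dots,\eta(e_k)=1]=\det[\widehat f(e_j-e_i)]_{1\le i,j\le k}$ (it exists and is translation invariant). $\mathcal{T}$ is the set of (complex) trigonometric polynomials on $\mathbb{T}^d$, i.e. finite linear combinations of $x\mapsto e^{2\pi i k\cdot x}$, $k\in\mathbb{Z}^d$. $L^2(1/f):=\{h:\mathbb{T}^d\to\mathbb{C} : \int_{\mathbb{T}^d}\frac{|h|^2}{f}\,d\lambda_d<\infty\}$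 with the corresponding norm and the convention $0/0:=0$ (so $h$ must vanish a.e. where $f$ does). Let $B^d_n:=[-n,n]^d\cap\mathbb{Z}^d$. Define $((\mathbb{P}^f)^+)_n:=\lim_{k\to\infty}\mathbb{P}^f[\,\cdot\mid\eta\equiv1\text{ on }B^d_{n+k}\setminus B^d_n]$ (as a limit of the laws of the configuration on $B^d_n$), and $(\mathbb{P}^f)^+:=\lim_{n\to\infty}((\mathbb{P}^f)^+)_n$; both limits are in the weak$^*$ topology and exist, and $(\mathbb{P}^f)^+$ is a translation-invariant probability measure on $\{0,1\}^{\mathbb{Z}^d}$. $\delta_{\mathbf 0}$ is the point mass at the all-0 configuration. *)

(* Defs.v *)
From HB Require Import structures.
From mathcomp Require Import all_boot all_order all_algebra.
From mathcomp Require Import complex.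
From mathcomp Require Import all_classical all_reals all_analysis.

Set Implicit Arguments.
Unset Strict Implicit.
Unset Printing Implicit Defensive.

Import Order.TTheory GRing.Theory Num.Theory.
Import numFieldNormedType.Exports.

Local Open Scope classical_set_scope.
Local Open Scope complex_scope.
Local Open Scope ring_scope.

Section torus.
Context {R : realType}.

Definition consR n (x : measurableTypeR R * n.-tuple R) : n.+1.-tuple R :=
  [tuple of x.1 :: x.2].

Lemma measurable_consR n :
  measurable_fun [set: measurableTypeR R * n.-tuple R] (@consR n).
Proof. by apply: measurable_cons. Qed.

HB.instance Definition _ n :=
  @isMeasurableFun.Build _ _ (measurableTypeR R * n.-tuple R)%type
    (n.+1.-tuple R) (@consR n) (@measurable_consR n).

(* The d-fold product of Lebesgue measure on [0, 1]: the Borel measure on R^d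
   carried by a fundamental domain of Z^d.  Functions on the torus are encoded
   as Z^d-periodic functions on R^d, and their integral over the torus is their
   integral against this measure. *)
Fixpoint torus_measure d : probability (d.-tuple R) R :=
  if d is n.+1 then
    distribution (uniform_prob (@ltr01 R) \x torus_measure n)%E (@consR n)
  else dirac [tuple].

Definition translate d (x : d.-tuple R) (k : 'rV[int]_d) : d.-tuple R :=
  [tuple tnth x i + (k 0 i)%:~R | i < d].

Definition periodicZ d (Y : Type) (h : d.-tuple R -> Y) : Prop :=
  forall x k, h (translate x k) = h x.

Definition dotZ d (k : 'rV[int]_d) (x : d.-tuple R) : R :=
  \sum_(i < d) (k 0 i)%:~R * tnth x i.

Definition cexp d (k : 'rV[int]_d) (x : d.-tuple R) : R[i] :=
  cos (2 * pi * dotZ k x) +i* sin (2 * pi * dotZ k x).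

Definition trig_poly d : set (d.-tuple R -> R[i]) :=
  [set h | exists (s : seq 'rV[int]_d) (c : 'rV[int]_d -> R[i]),
     h = (fun x => \sum_(k <- s) c k * cexp k x)].

Definition torus_cintegral d (h : d.-tuple R -> R[i]) : R[i] :=
  (\int[torus_measure d]_x complex.Re (h x)) +i*
  (\int[torus_measure d]_x complex.Im (h x)).

Definition fourier d (f : d.-tuple R -> R) (k : 'rV[int]_d) : R[i] :=
  torus_cintegral (fun x => (f x)%:C * cexp (- k) x).

(* [|h|^2 / f]; division in [\bar R] satisfies [0 / 0 = 0] and
   [a / 0 = +oo] for [0 < a]. *)
Definition sqnorm_div d (f : d.-tuple R -> R) (h : d.-tuple R -> R[i])
    (x : d.-tuple R) : \bar R :=
  ((ComplexField.Normc.normc (h x) ^+ 2)%:E / (f x)%:E)%E.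

Definition L2inv d (f : d.-tuple R -> R) : set (d.-tuple R -> R[i]) :=
  [set h | [/\ periodicZ h,
    measurable_fun setT (fun x => complex.Re (h x)),
    measurable_fun setT (fun x => complex.Im (h x)) &
    (\int[torus_measure d]_x sqnorm_div f h x < +oo)%E]].

Definition L2inv_norm d (f : d.-tuple R -> R) (h : d.-tuple R -> R[i]) :
    \bar R :=
  ((\int[torus_measure d]_x sqnorm_div f h x) `^ 2^-1)%E.

Definition L2inv_closure d (f : d.-tuple R -> R)
    (A : set (d.-tuple R -> R[i])) : set (d.-tuple R -> R[i]) :=
  [set h | L2inv f h /\ forall e : R, 0 < e ->
    exists2 g, A g & (L2inv_norm f (fun x => h x - g x)%R < e%:E)%E].

End torus.

(* {0,1}^(Z^d) with the product topology and its Borel sigma-algebra. *)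
Definition config_space (d : nat) := {ptws 'rV[int]_d -> bool}.

Definition config (d : nat) := g_sigma_algebraType (@open (config_space d)).

Definition all_ones d (A : set 'rV[int]_d) : set (config d) :=
  [set eta | forall e, A e -> eta e = true].

Definition all_zero d : config d := fun _ => false.
Arguments all_zero d : clear implicits.

Definition box d (n : nat) : set 'rV[int]_d :=
  [set e | forall i, `|e 0 i| <= n%:Z].

Section determinantal.
Context {R : realType} {d : nat}.

(* [P] is the determinantal measure P^f. *)
Definition determinantal (f : d.-tuple R -> R) (P : probability (config d) R) :
    Prop :=
  forall (k : nat) (e : 'I_k -> 'rV[int]_d), (1 <= k)%N -> injective e ->
    (fine (P (all_ones (range e))))%:C =
    \det (\matrix_(i < k, j < k) fourier f (e j - e i)).

Definition cond_mean (P : probability (config d) R) (C : set (config d))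
    (g : config d -> R) : R :=
  (\int[P]_(eta in C) g eta) / fine (P C).

Definition depends_on (A : set 'rV[int]_d) (g : config d -> R) : Prop :=
  forall eta eta' : config d, (forall e, A e -> eta e = eta' e) ->
    g eta = g eta'.

(* The marginal of [mu] on {0,1}^(B_n) is the weak* limit, as k grows, of the
   law on {0,1}^(B_n) of [P] conditioned on all 1s on B_{n+k} \ B_n.  Since B_n
   is finite, all functions on {0,1}^(B_n) are continuous.  [mu] is
   unconstrained off B_n, which is harmless in [plus_limit]: a continuous
   function is a uniform limit of functions of finitely many coordinates. *)
Definition plus_box (P : probability (config d) R) (n : nat)
    (mu : probability (config d) R) : Prop :=
  forall g : config d -> R, depends_on (box n) g ->
    cond_mean P (all_ones (box (n + k) `\` box n)) g @[k --> \oo] -->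
    \int[mu]_eta g eta.

Definition weak_star_cvg (mu : nat -> probability (config d) R)
    (nu : probability (config d) R) : Prop :=
  forall g : config_space d -> R, continuous g ->
    (\int[mu n]_eta g eta) @[n --> \oo] --> \int[nu]_eta g eta.

(* [Q] is P^+, the limit of the measures (P^+)_n. *)
Definition plus_limit (P Q : probability (config d) R) : Prop :=
  exists mu : nat -> probability (config d) R,
    (forall n, plus_box P n (mu n)) /\ weak_star_cvg mu Q.

Definition same_law (P Q : probability (config d) R) : Prop :=
  forall A : set (config d), measurable A -> P A = Q A.

End determinantal.

(* Main.v *)
(* Write e_k for the exponentials and <u, v> for the integral of f u v^*; the
   matrix of P^f is the Gram matrix <e_i, e_j>. Conditioning on 1s on a finite
   set B replaces it by a Schur complement, the Gram matrix of the components
   of the e_i orthogonal in L^2(f) to the exponentials in B. Let V_n be the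
   closed span of the exponentials outside B_n. A function g is orthogonal to
   V_n if and only if f g is a trigonometric polynomial with frequencies in
   B_n, and g -> f g is an isometry from L^2(f) to L^2(1/f).

   If f is a limit of trigonometric polynomials in L^2(1/f), then the projection
   of each e_i to V_n tends to 0, so the conditioned kernels tend to that of P^f.
   If no nonzero trigonometric polynomial lies in L^2(1/f), then each V_n is all
   of L^2(f), the conditioned kernels tend to 0, and the limit law is the point
   mass at 0. Finally, if a nonzero T lies in L^2(1/f), then T vanishes only on a
   null set, trigonometric polynomials are dense in L^2(|T|^2/f), and f / T
   belongs to that space; hence f is a limit of multiples T p in L^2(1/f). *)

Require Import Defs.
From mathcomp Require Import all_boot all_order all_algebra.
From mathcomp Require Import complex.
From mathcomp Require Import all_classical all_reals all_analysis.
From mathcomp Require Import measurable_realfun zify ring lra.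

Set Implicit Arguments.
Unset Strict Implicit.
Unset Printing Implicit Defensive.

Import Order.TTheory GRing.Theory Num.Theory.
Import numFieldNormedType.Exports.

Local Open Scope classical_set_scope.
Local Open Scope complex_scope.
Local Open Scope ring_scope.

(** * Complex integrals on the torus *)

(** The space L^2(f) is never completed, and no projection onto the infinite-dimensional V_n is
    formed. Inner products are taken only between bounded functions, and projections only onto spans
    of finitely many exponentials, so the limits in k and n become estimates that survive both
    limits. The obstacle is then to produce a T in L^2(1/f) when the limit law is not the point
    mass: the limit of f q_k, for q_k the component of an exponential orthogonal to the k-th collar,
    is known only through its Fourier coefficients. Duality closes this gap. Cauchy-Schwarz, passed
    to the limit, bounds the functional that T defines on trigonometric polynomials by the norm of
    L^2(f), and such a bound forces |T|^2 / f to be integrable. Since f may vanish, this is tested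
    on |T|^2 / (f + 1/(m+1)), which increases to |T|^2 / f with its infinite values. The implication
    from (i) to (iii) is not direct: if (iii) fails the limit law is the point mass, which differs
    from P^f because a site is occupied with probability equal to the integral of f. *)

Section complex_parts.
Context {R : realType}.
Implicit Types z w : R[i].

Lemma ReD z w : complex.Re (z + w) = complex.Re z + complex.Re w.
Proof. by case: z; case: w. Qed.

Lemma ImD z w : complex.Im (z + w) = complex.Im z + complex.Im w.
Proof. by case: z; case: w. Qed.

Lemma ReN z : complex.Re (- z) = - complex.Re z.
Proof. by case: z. Qed.

Lemma ImN z : complex.Im (- z) = - complex.Im z.
Proof. by case: z. Qed.

Lemma ReM z w : complex.Re (z * w) =
  complex.Re z * complex.Re w - complex.Im z * complex.Im w.
Proof. by case: z; case: w. Qed.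

Lemma ImM z w : complex.Im (z * w) =
  complex.Re z * complex.Im w + complex.Im z * complex.Re w.
Proof. by case: z; case: w. Qed.

Lemma Re_conjc z : complex.Re z^*%C = complex.Re z.
Proof. by case: z. Qed.

Lemma Im_conjc z : complex.Im z^*%C = - complex.Im z.
Proof. by case: z. Qed.

Definition sqn z : R := complex.Re z ^+ 2 + complex.Im z ^+ 2.

Lemma sqn_ge0 z : 0 <= sqn z.
Proof. by rewrite addr_ge0 // sqr_ge0. Qed.

Lemma sqn0 : sqn 0 = 0.
Proof. by rewrite /sqn /= expr0n addr0. Qed.

Lemma sqn_eq0 z : (sqn z == 0) = (z == 0).
Proof.
by case: z => a b; rewrite /sqn /= paddr_eq0 ?sqr_ge0 // !sqrf_eq0 eq_complex.
Qed.

Lemma sqr_normc z : ComplexField.Normc.normc z ^+ 2 = sqn z.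
Proof. by case: z => a b /=; rewrite sqr_sqrtr // addr_ge0 // sqr_ge0. Qed.

Lemma sqnM z w : sqn (z * w) = sqn z * sqn w.
Proof. by rewrite /sqn ReM ImM; ring. Qed.

Lemma sqnN z : sqn (- z) = sqn z.
Proof. by rewrite /sqn ReN ImN !sqrrN. Qed.

Lemma sqn_conjc z : sqn z^*%C = sqn z.
Proof. by rewrite /sqn Re_conjc Im_conjc sqrrN. Qed.

Lemma sqn_real (a : R) : sqn a%:C = a ^+ 2.
Proof. by rewrite /sqn /= expr0n addr0. Qed.

Lemma sqnV z : sqn z^-1 = (sqn z)^-1.
Proof.
have [->|z0] := eqVneq z 0; first by rewrite invr0 sqn0 invr0.
have sz : sqn z != 0 by rewrite sqn_eq0.
by apply: (mulfI sz); rewrite -sqnM !divff // /sqn /= expr1n expr0n addr0.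
Qed.

Lemma mulc_conj z : z * z^*%C = (sqn z)%:C.
Proof.
by apply/eqP; rewrite eq_complex ReM ImM Re_conjc Im_conjc /sqn /=;
  apply/andP; split; apply/eqP; ring.
Qed.

Lemma sqnD_le z w : sqn (z + w) <= 2 * sqn z + 2 * sqn w.
Proof.
rewrite /sqn ReD ImD -subr_ge0.
set a := complex.Re z; set b := complex.Im z.
set c := complex.Re w; set e := complex.Im w.
have -> : 2 * (a ^+ 2 + b ^+ 2) + 2 * (c ^+ 2 + e ^+ 2)
  - ((a + c) ^+ 2 + (b + e) ^+ 2) = (a - c) ^+ 2 + (b - e) ^+ 2 by ring.
by rewrite addr_ge0 // sqr_ge0.
Qed.

Lemma eq_complexP z w : complex.Re z = complex.Re w ->
  complex.Im z = complex.Im w -> z = w.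
Proof. by case: z; case: w => /= ? ? ? ? -> ->. Qed.

End complex_parts.

(** On nonnegative reals the inverse, with 0 sent to 0, is the power with exponent -1, whose
    measurability is known. *)
Lemma measurable_invr_ge0 {R : realType} d (T : measurableType d) (g : T -> R) :
  measurable_fun setT g -> (forall x, 0 <= g x) ->
  measurable_fun setT (fun x => (g x)^-1).
Proof.
move=> mg g0; under eq_fun => x do rewrite -powR_inv1 //.
by apply: (@measurableT_comp _ _ _ _ _ _ (@powR R ^~ (-1))).
Qed.

Section torus_integral.
Context {R : realType} {d : nat}.
Local Notation X := (d.-tuple R).
Local Notation lam := (@torus_measure R d).

(** Every function put under a complex integral is bounded everywhere, so linearity carries no
    integrability conditions. Unbounded quotients such as [f / T] occur only inside nonnegative
    extended integrals. *)
Definition bmeas (h : X -> R[i]) : Prop :=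
  [/\ measurable_fun setT (fun x => complex.Re (h x)),
      measurable_fun setT (fun x => complex.Im (h x)) &
      exists M : R, forall x, `|complex.Re (h x)| <= M /\
                              `|complex.Im (h x)| <= M].

Lemma bmeas_cst c : bmeas (fun=> c).
Proof.
split; [exact: measurable_cst|exact: measurable_cst|].
exists (Num.max `|complex.Re c| `|complex.Im c|) => _.
by rewrite !le_max !lexx orbT.
Qed.

Lemma bmeasD g h : bmeas g -> bmeas h -> bmeas (fun x => g x + h x).
Proof.
move=> [rg ig [M gM]] [rh ih [N hN]]; split.
- by under eq_fun do rewrite ReD; exact: measurable_funD.
- by under eq_fun do rewrite ImD; exact: measurable_funD.
- exists (M + N) => x; rewrite ReD ImD; have [? ?] := gM x; have [? ?] := hN x.
  by split; rewrite (le_trans (ler_normD _ _))// lerD.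
Qed.

Lemma bmeasN h : bmeas h -> bmeas (fun x => - h x).
Proof.
move=> [rh ih [N hN]]; split.
- by under eq_fun do rewrite ReN; exact: measurableT_comp.
- by under eq_fun do rewrite ImN; exact: measurableT_comp.
- by exists N => x; rewrite ReN ImN !normrN.
Qed.

Lemma bmeasB g h : bmeas g -> bmeas h -> bmeas (fun x => g x - h x).
Proof. by move=> bg bh; apply: bmeasD => //; exact: bmeasN. Qed.

Lemma bmeas_conj h : bmeas h -> bmeas (fun x => (h x)^*%C).
Proof.
move=> [rh ih [N hN]]; split.
- by under eq_fun do rewrite Re_conjc.
- by under eq_fun do rewrite Im_conjc; exact: measurableT_comp.
- by exists N => x; rewrite Re_conjc Im_conjc normrN.
Qed.

Lemma bmeasM g h : bmeas g -> bmeas h -> bmeas (fun x => g x * h x).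
Proof.
move=> [rg ig [M gM]] [rh ih [N hN]]; split.
- under eq_fun do rewrite ReM.
  by apply: measurable_funB; exact: measurable_funM.
- under eq_fun do rewrite ImM.
  by apply: measurable_funD; exact: measurable_funM.
- exists (M * N + M * N) => x; rewrite ReM ImM.
  have [? ?] := gM x; have [? ?] := hN x.
  by split; rewrite (le_trans (ler_normD _ _))// ?normrN !normrM lerD// ler_pM.
Qed.

Lemma bmeas_sum (I : Type) (s : seq I) (F : I -> X -> R[i]) :
  (forall i, bmeas (F i)) -> bmeas (fun x => \sum_(i <- s) F i x).
Proof.
move=> bF; elim: s => [|i s IH].
  by under eq_fun do rewrite big_nil; exact: bmeas_cst.
by under eq_fun do rewrite big_cons; exact: bmeasD.
Qed.

Lemma bmeas_real (g : X -> R) (M : R) : measurable_fun setT g ->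
  (forall x, `|g x| <= M) -> bmeas (fun x => (g x)%:C).
Proof.
move=> mg gM; split => //=.
by exists M => x; rewrite normr0 gM (le_trans _ (gM x)).
Qed.

Lemma measurable_dotZ (k : 'rV[int]_d) :
  measurable_fun setT (dotZ k : X -> R).
Proof.
apply: measurable_sum => i; apply: measurable_funM => //.
exact: measurable_tnth.
Qed.

Lemma bmeas_cexp (k : 'rV[int]_d) : bmeas (cexp k).
Proof.
have m2 : measurable_fun setT (fun x : X => 2 * pi * dotZ k x).
  by apply: measurable_funM => //; exact: measurable_dotZ.
split => /=.
- by apply: measurableT_comp m2; apply: continuous_measurable_fun; exact: continuous_cos.
- by apply: measurableT_comp m2; apply: continuous_measurable_fun; exact: continuous_sin.
- by exists 1 => x; rewrite cos_max sin_max.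
Qed.

Lemma bmeas_trig (T : X -> R[i]) : trig_poly T -> bmeas T.
Proof.
move=> [s [c ->]]; apply: bmeas_sum => k; apply: bmeasM; first exact: bmeas_cst.
exact: bmeas_cexp.
Qed.

Lemma bmeas_integrable h : bmeas h ->
  lam.-integrable setT (fun x => (complex.Re (h x))%:E) /\
  lam.-integrable setT (fun x => (complex.Im (h x))%:E).
Proof.
move=> [rh ih [M hM]].
have fin : (lam setT < +oo)%E by rewrite probability_setT ltry.
by split; apply: measurable_bounded_integrable => //;
  exists M; split; rewrite ?num_real// => N MN x _; have [? ?] := hM x;
  apply: ltW; apply: le_lt_trans MN.
Qed.

Local Notation cint := (@torus_cintegral R d).

Lemma cintD g h : bmeas g -> bmeas h ->
  cint (fun x => g x + h x) = cint g + cint h.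
Proof.
move=> /bmeas_integrable[rg ig] /bmeas_integrable[rh ih].
apply: eq_complexP; rewrite ?ReD ?ImD /=.
  by under [in LHS]eq_Rintegral do rewrite ReD; rewrite RintegralD.
by under [in LHS]eq_Rintegral do rewrite ImD; rewrite RintegralD.
Qed.

Lemma cintZ c h : bmeas h -> cint (fun x => c * h x) = c * cint h.
Proof.
move=> /bmeas_integrable[rh ih].
have iZ a (g : X -> R) : lam.-integrable setT (EFin \o g) ->
    lam.-integrable setT (EFin \o (fun x => a * g x)).
  by move=> ig; exact: (integrableZl measurableT a ig).
apply: eq_complexP; rewrite ?ReM ?ImM /=.
  under [in LHS]eq_Rintegral do rewrite ReM.
  by rewrite RintegralB ?RintegralZl //; exact: iZ.
under [in LHS]eq_Rintegral do rewrite ImM.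
by rewrite RintegralD ?RintegralZl //; exact: iZ.
Qed.

Lemma cintN h : bmeas h -> cint (fun x => - h x) = - cint h.
Proof.
by move=> bh; under eq_fun do rewrite -mulN1r; rewrite cintZ // mulN1r.
Qed.

Lemma cintB g h : bmeas g -> bmeas h ->
  cint (fun x => g x - h x) = cint g - cint h.
Proof.
by move=> bg bh; rewrite (@cintD g (fun x => - h x)) ?cintN //; exact: bmeasN.
Qed.

Lemma cint_sum (I : Type) (s : seq I) (F : I -> X -> R[i]) :
  (forall i, bmeas (F i)) ->
  cint (fun x => \sum_(i <- s) F i x) = \sum_(i <- s) cint (F i).
Proof.
move=> bF; elim: s => [|i s IH].
  rewrite big_nil; under eq_fun do rewrite big_nil.
  by apply: eq_complexP; rewrite /= Rintegral_cst // mul0r.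
rewrite big_cons -IH -cintD //; last exact: bmeas_sum.
by under eq_fun do rewrite big_cons.
Qed.

Lemma cint_conj h : bmeas h -> cint (fun x => (h x)^*%C) = (cint h)^*%C.
Proof.
move=> /bmeas_integrable[rh ih].
apply: eq_complexP; rewrite ?Re_conjc ?Im_conjc /=.
  by under eq_Rintegral do rewrite Re_conjc.
under eq_Rintegral do rewrite Im_conjc -mulN1r.
by rewrite RintegralZl // mulN1r.
Qed.

Lemma cint_cst c : cint (fun=> c) = c.
Proof.
rewrite /torus_cintegral !Rintegral_cst //.
have -> : fine (torus_measure d setT) = 1 :> R by rewrite probability_setT.
by rewrite !mulr1; case: c.
Qed.

End torus_integral.

(** * Exponentials on the torus *)

Section unit_circle.
Context {R : realType}.

Definition ecirc (t : R) : R[i] := cos (2 * pi * t) +i* sin (2 * pi * t).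

Lemma ecirc0 : ecirc 0 = 1.
Proof. by rewrite /ecirc mulr0 cos0 sin0. Qed.

Lemma ecircD s t : ecirc (s + t) = ecirc s * ecirc t.
Proof.
apply: eq_complexP; rewrite ?ReM ?ImM /= mulrDr ?cosD ?sinD //.
by rewrite addrC [X in X + _]mulrC [X in _ + X]mulrC addrC.
Qed.

Lemma ecircN t : ecirc (- t) = (ecirc t)^*%C.
Proof. by rewrite /ecirc mulrN cosN sinN. Qed.

Lemma sqn_ecirc t : sqn (ecirc t) = 1.
Proof. by rewrite /sqn cos2Dsin2. Qed.

Lemma ecirc_neq0 t : ecirc t != 0.
Proof. by rewrite -sqn_eq0 sqn_ecirc oner_eq0. Qed.

Lemma ecirc_natM (n : nat) t : ecirc (n%:R * t) = ecirc t ^+ n.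
Proof.
elim: n => [|n IH]; first by rewrite mul0r ecirc0 expr0.
by rewrite -natr1 mulrDl mul1r ecircD IH exprSr.
Qed.

(** For 0 <= x < y < 1, equality would give cos (2 pi (y - x)) = 1, hence sin (pi (y - x)) = 0,
    although pi (y - x) lies strictly between 0 and pi. *)
Lemma ecirc_inj : {in `[0, 1[ &, injective ecirc}.
Proof.
suff H x y : 0 <= x -> x < y -> y < 1 -> ecirc x <> ecirc y.
  move=> x y; rewrite !in_itv /= => /andP[x0 x1] /andP[y0 y1] e.
  case: (ltgtP x y) => // xy; first by have := H _ _ x0 xy y1 e.
  by have := H _ _ y0 xy x1 (esym e).
move=> x0 xy y1 [ec es].
have : cos (2 * pi * (y - x)) = 1 :> R.
  by rewrite mulrBr cosB ec es -!expr2 cos2Dsin2.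
have -> : 2 * pi * (y - x) = (pi * (y - x)) *+ 2 :> R by rewrite mulr2n; ring.
have p0 := pi_gt0 R; have yx : 0 < y - x by rewrite subr_gt0.
have s0 : 0 < sin (pi * (y - x)).
  by apply: sin_gt0_pi; rewrite mulr_gt0 //= gtr_pMr //; lra.
rewrite cos_mulr2n cos2sin2 => c1.
by have := exprn_gt0 2 s0; rewrite ltNge; apply/negP/negPn; lra.
Qed.

Lemma continuous_ecirc_arg (m a : R) :
  continuous (fun t : R => cos (2 * pi * (m * t) + a)) /\
  continuous (fun t : R => sin (2 * pi * (m * t) + a)).
Proof.
have c : continuous (fun t : R => 2 * pi * (m * t) + a).
  move=> t; apply: cvgD; last exact: cvg_cst.
  by apply: cvgM; [exact: cvg_cst|apply: cvgM => //; exact: cvg_cst].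
split=> t; apply: continuous_comp; first exact: c.
  exact: continuous_cos.
exact: c.
exact: continuous_sin.
Qed.

Lemma ecirc_int (m : int) : ecirc m%:~R = 1.
Proof.
have e1 : ecirc 1 = 1.
  by rewrite /ecirc mulr1 mulrC mulr_natr cos2pi sin2pi.
have en (n : nat) : ecirc n%:R = 1.
  by rewrite -[n%:R]mulr1 ecirc_natM e1 expr1n.
case: m => n; first exact: en.
by rewrite NegzE mulrNz ecircN en conjc1.
Qed.

Local Notation U := (uniform_prob (@ltr01 R)).

Lemma uniform_prob_setC01 : U (~` `[0, 1[%classic) = 0%E.
Proof.
rewrite /uniform_prob integral_uniform_pdf.
rewrite (_ : _ `&` _ = [set 1]); first by rewrite integral_set1.
apply/seteqP; split=> [x /=|_ ->]; rewrite /= !in_itv /=.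
    by move=> [nx /andP[x0 x1]]; apply/eqP; rewrite eq_le x1 leNgt /=;
    apply/negP => x1'; apply: nx; rewrite x0.
by rewrite ltxx andbF lexx ler01.
Qed.

Lemma uniform_prob_finite (A : set R) : finite_set A -> U A = 0%E.
Proof.
move=> /finite_set_countable cA.
have /null_content_dominatesP h := dominates_uniform_prob (@ltr01 R).
apply: h; first exact: countable_measurable.
exact: countable_lebesgue_measure0.
Qed.

(** Multiplied by a power of [ecirc x] that makes all exponents nonnegative, the sum is a polynomial
    in [ecirc x]. The point [x0] shows that it is not the zero polynomial, so it has finitely many
    roots, each reached at most once on [0, 1[. *)
Lemma ecirc_sum_null (I : Type) (s : seq I) (m : I -> int) (a : I -> R[i])
    (x0 : R) :
  \sum_(k <- s) a k * ecirc ((m k)%:~R * x0) != 0 ->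
  exists2 N, measurable N & U N = 0%E /\
    [set x | \sum_(k <- s) a k * ecirc ((m k)%:~R * x) = 0] `<=` N.
Proof.
move=> g0.
pose N := (\sum_(k <- s) `|m k|)%N.
have N_ge : all (fun k => `|m k| <= N)%N s.
  rewrite /N; elim: s {g0 N} => //= k s IH; rewrite big_cons leq_addr /=.
  by apply: sub_all IH => j /leq_trans -> //; rewrite leq_addl.
clearbody N.
pose n k := `|(m k + N%:Z)%R|%N.
pose P : {poly R[i]} := \sum_(k <- s) a k *: 'X^(n k).
have PE x : P.[ecirc x] =
    (\sum_(k <- s) a k * ecirc ((m k)%:~R * x)) * ecirc x ^+ N.
  rewrite /P horner_sum mulr_suml; elim: s N_ge {g0 P} => [|k s IH] /=.
    by rewrite !big_nil.
  move=> /andP[kN /IH {}IH]; rewrite !big_cons IH; congr (_ + _).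
  rewrite !hornerE -mulrA; congr (_ * _).
  rewrite -!ecirc_natM -ecircD -mulrDl; congr (ecirc (_ * _)).
  have h : (n k)%:Z = m k + N%:Z by rewrite /n; lia.
  by rewrite -[LHS]/((n k)%:Z%:~R) h rmorphD.
have P0 : P != 0.
  apply/eqP => P0; have /eqP := PE x0; rewrite P0 horner0 eq_sym mulf_eq0.
  by rewrite (negbTE g0) expf_eq0 (negbTE (ecirc_neq0 _)) andbF.
have [rs Prs] := closed_field_poly_normal P.
pose F := `[0, 1[%classic `&` ecirc @^-1` [set` rs].
have fF : finite_set F.
  (* [g] picks a point of [0, 1[ above a root; injectivity of [ecirc] there puts [F] inside the
     image of the finite list [rs]. *)
  pose g r := xget 0 (`[0, 1[%classic `&` ecirc @^-1` [set r]).
  apply: (@sub_finite_set _ _ (g @` [set` rs])); last exact: finite_image.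
  move=> x [x01 xrs]; exists (ecirc x) => //.
  have [] : (`[0, 1[%classic `&` ecirc @^-1` [set ecirc x]) (g (ecirc x)).
    by rewrite /g; apply: xgetPex; exists x.
  by move=> g01 ge; apply: ecirc_inj => //; exact: mem_set.
exists (F `|` ~` `[0, 1[%classic).
  apply: measurableU; first exact/countable_measurable/finite_set_countable.
  by apply: measurableC.
split.
  apply/eqP; rewrite eq_le measure_ge0 andbT.
  apply: le_trans (measureU2 _ _ _) _.
  - exact/countable_measurable/finite_set_countable.
  - by apply: measurableC.
  by rewrite /= uniform_prob_finite // uniform_prob_setC01 adde0.
move=> x /= gx; case: (boolP (x \in `[0, 1[)) => [x01|/negP]; last by right.
left; split=> //; move: (PE x); rewrite gx mul0r Prs hornerZ => /eqP.
by rewrite mulf_eq0 lead_coef_eq0 (negbTE P0) /= -/(root _ _) root_prod_XsubC.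
Qed.

(** The added 1 keeps the integrand nonnegative, as the formula for the uniform law and Tonelli's
    theorem require. The phase [a] will absorb the other coordinates of [dotZ], and the value
    [- (pi / 2)] turns the cosine into a sine. *)
Lemma integral_uniform_cos (m : int) (a : R) : m != 0 ->
  (\int[U]_x (1 + cos (2 * pi * (m%:~R * x) + a))%:E = 1)%E.
Proof.
move=> m0.
have c1 : continuous (fun x : R => 1 + cos (2 * pi * (m%:~R * x) + a)).
  move=> x; apply: cvgD; first exact: cvg_cst.
  exact: (continuous_ecirc_arg m%:~R a).1.
have c0 : 2 * pi * m%:~R != 0 :> R.
  by rewrite !mulf_neq0 ?intr_eq0 // ?pnatr_eq0 // gt_eqF // pi_gt0.
pose F (x : R) := x + (2 * pi * m%:~R)^-1 * sin (2 * pi * (m%:~R * x) + a).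
have dF (x : R) : is_derive x (1 : R) F (1 + cos (2 * pi * (m%:~R * x) + a)).
  have -> : F = fun x => x + (2 * pi * m%:~R)^-1 * sin ((2 * pi * m%:~R) * x + a).
    by apply/funext => y; rewrite /F mulrA.
  apply: is_deriveD; rewrite mulrA.
  set b := 2 * pi * m%:~R.
  have -> : cos (b * x + a) = b^-1 * (cos (b * x + a) * b).
    by rewrite mulrCA mulVf ?mulr1.
  apply: (@is_deriveZ _ _ _ (fun x => sin (b * x + a))).
  apply: (@is_derive1_comp _ sin (fun x => b * x + a)).
  rewrite -[X in is_derive _ _ _ X]addr0 -{2}[b]mulr1.
  by apply: is_deriveD; apply: is_deriveZ.
rewrite integral_uniform; last 2 first.
- by apply/measurable_EFinP; exact: continuous_measurable_fun.
- by move=> x; rewrite lee_fin -lerBlDl add0r cos_geN1.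
rewrite subr0 invr1 mul1e (@continuous_FTC2 _ _ F) //; first last.
- by move=> x _; rewrite derive1E; exact: derive_val.
- split.
  + by move=> x _; exact: ex_derive.
  + apply: cvg_at_right_filter; apply: differentiable_continuous.
    exact/derivable1_diffP.
  + apply: cvg_at_left_filter; apply: differentiable_continuous.
    exact/derivable1_diffP.
- by apply: continuous_subspaceT.
have [es ec] : sin (2 * pi * m%:~R) = 0 :> R /\ cos (2 * pi * m%:~R) = 1 :> R.
  by have [] := ecirc_int m.
rewrite /F mulr1 !mulr0 !add0r sinD es ec mul0r mul1r add0r -EFinB.
by rewrite addrK.
Qed.

End unit_circle.

Section torus.
Context {R : realType}.
Local Notation U := (uniform_prob (@ltr01 R)).
Local Notation lam := (@torus_measure R _).

Lemma tnth_consR0 n (x : R) (y : n.-tuple R) : tnth (consR (x, y)) ord0 = x.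
Proof. by []. Qed.

Lemma tnth_consR_lift n (x : R) (y : n.-tuple R) (i : 'I_n) :
  tnth (consR (x, y)) (lift ord0 i) = tnth y i.
Proof. by rewrite /consR /= tnthS. Qed.

Lemma dotZ_consR n (k : 'rV[int]_n.+1) (x : R) (y : n.-tuple R) :
  dotZ k (consR (x, y)) =
  (k 0 ord0)%:~R * x + dotZ (\row_i k 0 (lift ord0 i)) y.
Proof.
rewrite /dotZ big_ord_recl tnth_consR0; congr (_ + _).
by apply: eq_bigr => i _; rewrite tnth_consR_lift mxE.
Qed.

Lemma ge0_integral_torusS n (g : n.+1.-tuple R -> \bar R) :
  measurable_fun setT g -> (forall x, 0 <= g x)%E ->
  (\int[torus_measure n.+1]_x g x =
   \int[torus_measure n]_y \int[U]_x g (consR (x, y)))%E.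
Proof.
move=> mg g0; rewrite ge0_integral_distribution //.
rewrite (@fubini_tonelli2 _ _ _ _ _ U (torus_measure n)) //.
  by apply: measurableT_comp mg _; exact: measurable_consR.
by move=> x; exact: g0.
Qed.

Lemma measure_indic d (T : measurableType d) (mu : measure T R) (A : set T) :
  measurable A -> (mu A = \int[mu]_x (\1_A x)%:E)%E.
Proof. by move=> mA; rewrite integral_indic // setIT. Qed.

Lemma integral_prob_cst d (T : measurableType d) (P : probability T R) (r : R) :
  (\int[P]_x r%:E = r%:E)%E.
Proof.
rewrite integral_cst // [X in (_ * X)%E](_ : _ = 1%E) ?mule1 //.
exact: probability_setT.
Qed.

Lemma cexpE d (k : 'rV[int]_d) (x : d.-tuple R) : cexp k x = ecirc (dotZ k x).
Proof. by []. Qed.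

Lemma cexp0 d (x : d.-tuple R) : cexp 0 x = 1.
Proof. by rewrite cexpE /dotZ big1 ?ecirc0 // => i _; rewrite mxE mul0r. Qed.

Lemma measurable_cos_dotZ d (k : 'rV[int]_d) (a : R) :
  measurable_fun setT (fun x : d.-tuple R => cos (2 * pi * dotZ k x + a)).
Proof.
apply: (@measurableT_comp _ _ _ _ _ _ (@cos R)).
  by apply: continuous_measurable_fun; exact: continuous_cos.
apply: measurable_funD => //; apply: measurable_funM => //.
exact: measurable_dotZ.
Qed.

(** Integrate the first coordinate: if its frequency is nonzero the inner integral is 1 whatever the
    phase, and otherwise this coordinate disappears and the remaining frequency vector is still
    nonzero. *)
Lemma integral_torus_cos d (k : 'rV[int]_d) (a : R) : k != 0 ->
  (\int[torus_measure d]_x (1 + cos (2 * pi * dotZ k x + a))%:E = 1)%E.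
Proof.
elim: d k a => [|d IH] k a; first by rewrite [k]thinmx0 eqxx.
move=> k0; rewrite ge0_integral_torusS; first last.
- by move=> x; rewrite lee_fin -lerBlDl add0r cos_geN1.
- apply/measurable_EFinP; apply: measurable_funD => //.
  exact: measurable_cos_dotZ.
pose k' := \row_i k 0 (lift ord0 i).
under eq_integral => y _ do under eq_integral => x _ do
  rewrite dotZ_consR mulrDr -addrA.
have [k00|k00] := eqVneq (k 0 ord0) 0; last first.
  under eq_integral => y _ do rewrite integral_uniform_cos //.
  exact: integral_prob_cst.
under eq_integral => y _ do under eq_integral => x _ do
  rewrite k00 mul0r mulr0 add0r.
under eq_integral => y _ do rewrite integral_prob_cst.
apply: IH; apply: contra k0 => /eqP k'0; apply/eqP/rowP => i.
rewrite mxE; case: (unliftP ord0 i) => [j ->|->] //.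
by have := congr1 (fun v : 'rV_d => v 0 j) k'0; rewrite !mxE.
Qed.

Lemma cint_cexp d (k : 'rV[int]_d) :
  torus_cintegral (@cexp R d k) = (k == 0)%:R.
Proof.
have [->|k0] := eqVneq k 0.
  have -> : @cexp R d 0 = fun=> 1 by apply/funext => x; exact: cexp0.
  exact: cint_cst.
have I a : \int[torus_measure d]_x cos (2 * pi * dotZ k x + a) = 0 :> R.
  have m : (torus_measure d).-integrable setT
      (EFin \o (fun x => cos (2 * pi * dotZ k x + a)) : d.-tuple R -> \bar R).
    apply: measurable_bounded_integrable => //.
    - exact: fin_num_fun_lty.
    - exact: measurable_cos_dotZ.
    - exists 1; split; rewrite ?num_real// => N N1 x _.
      by rewrite /= (le_trans (cos_max _)) // ltW.
  have := integral_torus_cos a k0.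
  move=> /(congr1 fine); rewrite -/(Rintegral _ _ _) RintegralD //; last first.
    by apply: finite_measure_integrable_cst.
  rewrite Rintegral_cst //.
  have -> : fine (torus_measure d setT) = 1 :> R by rewrite probability_setT.
  by rewrite mulr1 /= => /eqP; rewrite addrC -subr_eq0 addrK => /eqP.
apply: eq_complexP => /=.
  by under eq_Rintegral do rewrite -[2 * pi * _]addr0; exact: I.
under eq_Rintegral => x _.
  have -> : sin (2 * pi * dotZ k x) = cos (2 * pi * dotZ k x + (- (pi / 2))).
    by rewrite cosB cos_pihalf sin_pihalf mulr0 mulr1 add0r.
  over.
exact: I.
Qed.

Lemma cexpD d (k l : 'rV[int]_d) (x : d.-tuple R) :
  cexp (k + l) x = cexp k x * cexp l x.
Proof.
rewrite !cexpE -ecircD /dotZ -big_split /=; congr ecirc.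
by apply: eq_bigr => i _; rewrite mxE rmorphD mulrDl.
Qed.

Lemma cexpN d (k : 'rV[int]_d) (x : d.-tuple R) :
  cexp (- k) x = (cexp k x)^*%C.
Proof.
rewrite !cexpE -ecircN /dotZ -sumrN; congr ecirc.
by apply: eq_bigr => i _; rewrite mxE rmorphN mulNr.
Qed.

Lemma sqn_cexp d (k : 'rV[int]_d) (x : d.-tuple R) : sqn (cexp k x) = 1.
Proof. exact: sqn_ecirc. Qed.

Lemma torus_coord_null d (i : 'I_d) (A : set R) : measurable A -> U A = 0%E ->
  torus_measure d [set x | A (tnth x i)] = 0%E.
Proof.
elim: d i => [[]//|d IH] i mA A0.
rewrite /= /distribution /pushforward.
case: (unliftP ord0 i) => [j ->|->].
  rewrite (_ : _ @^-1` _ = setT `*` [set y | A (tnth y j)]); last first.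
    apply/seteqP; split=> [[x y]|[x y]] /=; rewrite tnth_consR_lift //.
    by case.
  have mj : measurable [set y : d.-tuple R | A (tnth y j)].
    by rewrite -[X in measurable X]setTI; exact: measurable_tnth.
  rewrite product_measure1E // [X in (_ * X)%E](_ : _ = 0%E) ?mule0 //.
  exact: IH.
rewrite (_ : _ @^-1` _ = A `*` setT); last first.
  by apply/seteqP; split=> [[x y]|[x y]] /= => [|[]].
rewrite product_measure1E // [X in (X * _)%E](_ : _ = 0%E) ?mul0e //.
Qed.

(** [trig_poly] attaches coefficients to frequencies, so the indices that share a frequency have to
    be collected. *)
Lemma trig_poly_sum d (I : eqType) (r : seq I) (a : I -> R[i])
    (m : I -> 'rV[int]_d) :
  trig_poly (fun x => \sum_(i <- r) a i * cexp (m i) x).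
Proof.
exists (undup (map m r)), (fun k => \sum_(i <- r | m i == k) a i).
apply/funext => x; under [RHS]eq_bigr do rewrite mulr_suml.
rewrite (exchange_big_dep predT) //=; apply: eq_big_seq => i ir.
under eq_bigl do rewrite eq_sym.
rewrite big_mkcond (bigD1_seq (m i)) ?undup_uniq ?mem_undup ?map_f //=.
by rewrite eqxx big1 ?addr0 // => j /negbTE ->.
Qed.

Lemma measurable_sqn_comp d (h : d.-tuple R -> R[i]) :
  measurable_fun setT (fun x => complex.Re (h x)) ->
  measurable_fun setT (fun x => complex.Im (h x)) ->
  measurable_fun setT (fun x => sqn (h x)).
Proof. by move=> mr mi; apply: measurable_funD; exact: measurable_funX. Qed.

Lemma measurable_zeros d (h : d.-tuple R -> R[i]) : bmeas h ->
  measurable [set x | h x = 0].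
Proof.
move=> [rh ih _]; have mh := measurable_sqn_comp rh ih.
rewrite (_ : [set x | h x = 0] = (fun x => sqn (h x)) @^-1` [set 0]).
  by rewrite -[X in measurable X]setTI; exact: mh.
by apply/seteqP; split=> x /= => [->|/eqP]; rewrite ?sqn0 // sqn_eq0 => /eqP.
Qed.

(** Induction on the dimension. Freezing the first coordinate at that of a point where [T] is
    nonzero leaves a nonzero polynomial [T'] in the other coordinates. For [y] off the null zero set
    of [T'], the one-variable function [T (consR (_, y))] is nonzero somewhere, hence almost
    everywhere, and Tonelli concludes. *)
Lemma trig_poly_ae_neq0 d (T : d.-tuple R -> R[i]) : trig_poly T ->
  T <> (fun=> 0) -> torus_measure d [set x | T x = 0] = 0%E.
Proof.
elim: d T => [|d IH] T tT T0.
  rewrite (_ : [set x | T x = 0] = set0) ?measure0 //.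
  apply/seteqP; split=> // x /= Tx; apply: T0; apply/funext => y.
  by rewrite -Tx [x]tuple0 [y]tuple0.
have mZ := measurable_zeros (bmeas_trig tT).
have [x0 Tx0] : exists x, T x <> 0.
  by apply/not_existsP => h; apply: T0; apply/funext => x; have /contrapT := h x.
case: tT => s [c ET].
pose k' (k : 'rV[int]_d.+1) : 'rV[int]_d := \row_i k 0 (lift ord0 i).
have TE a y : T (consR (a, y)) =
    \sum_(k <- s) (c k * cexp (k' k) y) * ecirc ((k 0 ord0)%:~R * a).
  rewrite ET; apply: eq_bigr => k _.
  by rewrite cexpE dotZ_consR ecircD -mulrA [ecirc _ * _]mulrC.
pose a0 := tnth x0 ord0; pose y0 : d.-tuple R := [tuple tnth x0 (lift ord0 i) | i < d].
have x0E : x0 = consR (a0, y0).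
  apply: eq_from_tnth => i; case: (unliftP ord0 i) => [j ->|->] //.
  by rewrite tnth_consR_lift tnth_mktuple.
pose T' y := T (consR (a0, y)).
have tT' : trig_poly T'.
  rewrite /T' (_ : (fun y => _) = fun y =>
    \sum_(k <- s) (c k * ecirc ((k 0 ord0)%:~R * a0)) * cexp (k' k) y).
    exact: trig_poly_sum.
  by apply/funext => y; rewrite TE; apply: eq_bigr => k _; rewrite mulrAC.
have T'0 : T' <> (fun=> 0).
  by move=> /(congr1 (@^~ y0)); rewrite /T' -x0E.
have mI : measurable_fun setT (fun x : d.+1.-tuple R =>
    (\1_[set x | T x = 0] x)%:E : \bar R).
  by apply/measurable_EFinP; exact: measurable_indic.
rewrite (measure_indic (torus_measure d.+1) mZ).
rewrite ge0_integral_torusS //.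
have mZ' := measurable_zeros (bmeas_trig tT').
apply/eqP; rewrite eq_le integral_ge0 ?andbT; last first.
  by move=> y _; apply: integral_ge0 => x _; rewrite lee_fin.
rewrite -(IH _ tT' T'0) (measure_indic (torus_measure d) mZ').
apply: ge0_le_integral => //.
- by move=> y _; apply: integral_ge0 => x _; rewrite lee_fin.
- have mI2 := measurableT_comp mI (@measurable_consR R d).
  by apply: (measurable_fun_fubini_tonelli_G (m1 := U) _ mI2) => x /=; rewrite lee_fin.
- by apply/measurable_EFinP; exact: measurable_indic.
(* On the zeros of [T'] the inner integral is bounded by 1; elsewhere it is bounded by the measure
   of a null set. *)
move=> y _; have [Ty|/eqP Ty] := pselect (T' y = 0).
  rewrite [\1_[set x | T' x = 0] y]indicE mem_set //.
  rewrite -(integral_prob_cst U 1); apply: ge0_le_integral => //.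
  - apply: (measurableT_comp mI).
    by apply: (measurableT_comp (@measurable_consR R d)); exact: measurable_pair2.
  - by move=> x _; rewrite lee_fin indicE; case: (_ \in _).
move: (Ty); rewrite /T' TE => /ecirc_sum_null[N mN [N0 ZN]].
apply: (@le_trans _ _ (U N)); last by rewrite [X in (X <= _)%E]N0 lee_fin.
rewrite (measure_indic U mN).
apply: ge0_le_integral => //.
- apply: (measurableT_comp mI).
  by apply: (measurableT_comp (@measurable_consR R d)); exact: measurable_pair2.
- by apply/measurable_EFinP; exact: measurable_indic.
move=> x _; rewrite lee_fin !indicE; case: (boolP (x \in N)) => xN.
  by case: (_ \in _).
rewrite memNset //= TE => /ZN xN'; by rewrite mem_set in xN.
Qed.

End torus.

(** * Density of trigonometric polynomials in weighted L^2 spaces *)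

Section step_polynomials.
Context {R : realType}.

Lemma bernoulli_onem (t : R) (N : nat) : 0 <= t <= 1 ->
  1 - N%:R * t <= (1 - t) ^+ N.
Proof.
move=> /andP[t0 t1]; elim: N => [|N IH]; first by rewrite mul0r subr0 expr0.
rewrite exprS; apply: (@le_trans _ _ ((1 - t) * (1 - N%:R * t))).
  rewrite -natr1 -subr_ge0.
  rewrite (_ : _ - _ = N%:R * t ^+ 2); first by rewrite mulr_ge0 // sqr_ge0.
  by ring.
by rewrite ler_wpM2l // subr_ge0.
Qed.

Lemma bernoulli_ge (t : R) (N : nat) : 0 <= t -> 1 + N%:R * t <= (1 + t) ^+ N.
Proof.
move=> t0; elim: N => [|N IH]; first by rewrite mul0r addr0 expr0.
rewrite exprS; apply: (@le_trans _ _ ((1 + t) * (1 + N%:R * t))).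
  rewrite -natr1 -subr_ge0.
  rewrite (_ : _ - _ = N%:R * t ^+ 2); first by rewrite mulr_ge0 // sqr_ge0.
  by ring.
by rewrite ler_wpM2l // addr_ge0.
Qed.

(** With 1 + D = s / p, Bernoulli's inequality gives n <= (1 + D)^n / D, hence n p^n <= s^n / D. The
    intermediate [p] is positive even when [q] is 0, so the quotient makes sense. *)
Lemma cvg_nat_geometric (q : R) : 0 <= q < 1 ->
  n%:R * q ^+ n @[n --> \oo] --> (0 : R).
Proof.
move=> /andP[q0 q1].
pose p := (1 + q) / 2; pose s := (1 + p) / 2.
have [qp p0 ps s1] : [/\ q <= p, 0 < p, p < s & s < 1] by rewrite /s /p; split; lra.
pose D := s / p - 1.
have D0 : 0 < D by rewrite subr_gt0 ltr_pdivlMr // mul1r.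
apply: (@squeeze_cvgr _ _ _ _ (fun=> 0) (geometric D^-1 s)); last 2 first.
- exact: cvg_cst.
- by apply: cvg_geometric; rewrite ger0_norm // ltW // (lt_trans p0).
apply: nearW => n; rewrite mulr_ge0 ?exprn_ge0 //= /geometric /=.
apply: (@le_trans _ _ (n%:R * p ^+ n)).
  by rewrite ler_wpM2l // lerXn2r // nnegrE ltW.
rewrite ler_pdivlMl // mulrA [s](_ : _ = (1 + D) * p); last first.
  by rewrite /D addrC subrK divfK // gt_eqF.
rewrite [((1 + D) * p) ^+ n]exprMn; apply: ler_wpM2r; first by rewrite exprn_ge0 // ltW.
by apply: ltW; apply: lt_le_trans (bernoulli_ge n (ltW D0));
  rewrite [D * _]mulrC ltrDr.
Qed.

(* [stepp n] tends to the indicator of y < 1/2 also at 1/2: the factor [n] in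
   the exponent makes the limit there 0 rather than 1/e. *)
Definition stepp (n : nat) (y : R) : R := (1 - y ^+ n) ^+ (n * 2 ^ n).

Lemma stepp01 n y : 0 <= y <= 1 -> 0 <= stepp n y <= 1.
Proof.
move=> /andP[y0 y1]; have ? := exprn_ile1 n y0 y1; have ? := exprn_ge0 n y0.
by rewrite exprn_ge0 ?exprn_ile1 // ?subr_ge0 // lerBlDr lerDl.
Qed.

(** Write t = y^n and M = n 2^n, so that M t = n (2y)^n. Below 1/2, Bernoulli bounds the value from
    below by 1 - n (2y)^n. From 1/2 on, (1 - t)^M (1 + t)^M <= 1 while (1 + t)^M >= 1 + n, so the
    value is at most 1/(n+1). *)
Lemma cvg_stepp y : 0 <= y <= 1 ->
  stepp n y @[n --> \oo] --> (if y < 2^-1 then 1 else 0 : R).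
Proof.
move=> y01; have /andP[y0 y1] := y01.
have yn n : 0 <= y ^+ n <= 1 by rewrite exprn_ge0 // exprn_ile1.
have E n : (n * 2 ^ n)%:R * y ^+ n = n%:R * (2 * y) ^+ n :> R.
  by rewrite natrM natrX -mulrA exprMn.
case: ltP => [y2|y2].
  apply: (@squeeze_cvgr _ _ _ _ (fun n => 1 - n%:R * (2 * y) ^+ n) (fun=> 1)).
  - apply: nearW => n; have /andP[_ ->] := stepp01 n y01; rewrite andbT -E.
    exact: bernoulli_onem.
  - rewrite -[X in _ --> X]subr0; apply: cvgB; first exact: cvg_cst.
    by apply: cvg_nat_geometric; lra.
  - exact: cvg_cst.
apply: (@squeeze_cvgr _ _ _ _ (fun=> 0) harmonic); last 2 first.
- exact: cvg_cst.
- exact: cvg_harmonic.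
apply: nearW => n; have /andP[-> _] /= := stepp01 n y01.
have n0 : 0 < 1 + n%:R :> R by rewrite ltr_wpDr.
rewrite /harmonic /= -natr1 addrC -[X in _ <= X]mul1r ler_pdivlMr //.
have h : 1 + n%:R <= (1 + y ^+ n) ^+ (n * 2 ^ n).
  apply: le_trans (bernoulli_ge _ _); last by case/andP: (yn n).
  rewrite lerD2l E -[X in X <= _]mulr1 ler_wpM2l // exprn_ege1 //; lra.
apply: (le_trans (ler_wpM2l _ h)); first by case/andP: (stepp01 n y01).
have -> : stepp n y * (1 + y ^+ n) ^+ (n * 2 ^ n) =
    (1 - y ^+ n ^+ 2) ^+ (n * 2 ^ n).
  by rewrite /stepp -exprMn; congr (_ ^+ _); ring.
have /andP[u0 u1] := yn n.
by rewrite exprn_ile1 // ?subr_ge0 ?exprn_ile1 // lerBlDr lerDl sqr_ge0.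
Qed.

(* On the fundamental domain, the half-line is an arc, cut out by a cosine. *)
Lemma cos_arcE (a t : R) : 0 <= a < 1 -> 0 <= t < 1 ->
  (cos (2 * pi * (t - a / 2)) < cos (pi * a)) = (a < t).
Proof.
move=> /andP[a0 a1] /andP[t0 t1]; have p0 := pi_gt0 R.
have pa : pi * a \in `[0, pi] by rewrite in_itv /=; apply/andP; split; nra.
case: (ltP a t) => [lt_at|le_ta].
  case: (lerP (2 * pi * (t - a / 2)) pi) => [u1|u1].
    rewrite ltr_cos // ?in_itv /=; last by rewrite u1 andbT; nra.
    by nra.
  (* The argument is reflected into [0, pi]; it stays above [pi * a] precisely because t < 1. *)
  have -> : cos (2 * pi * (t - a / 2)) = cos (2 * pi * (1 - (t - a / 2))) :> R.
    have [c s] : cos (2 * pi) = 1 :> R /\ sin (2 * pi) = 0 :> R.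
      by have := @ecirc_int R 1; rewrite /ecirc mulr1 => -[].
    by rewrite [in RHS]mulrBr mulr1 cosB c s mul0r mul1r addr0.
  by rewrite ltr_cos // ?in_itv /=; nra.
have ua : `|2 * pi * (t - a / 2)| <= pi * a.
  by rewrite ler_norml; apply/andP; split; nra.
apply: negbTE; rewrite -[cos (2 * pi * _)]cos_norm ltr_cos //.
  by rewrite -leNgt.
by rewrite in_itv /= normr_ge0 /=; apply: le_trans ua _; nra.
Qed.

End step_polynomials.

Section trig_algebra.
Context {R : realType} {d : nat}.
Implicit Types g h : d.-tuple R -> R[i].

Lemma trig_polyD g h : trig_poly g -> trig_poly h ->
  trig_poly (fun x => g x + h x).
Proof.
move=> [s [c ->]] [s' [c' ->]].
pose r := [seq (c k, k) | k <- s] ++ [seq (c' k, k) | k <- s'].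
rewrite (_ : (fun x => _) = fun x => \sum_(p <- r) p.1 * cexp p.2 x).
  exact: trig_poly_sum.
by apply/funext => x; rewrite big_cat !big_map.
Qed.

Lemma trig_poly_bigsum (I : Type) (s : seq I) (F : I -> d.-tuple R -> R[i]) :
  (forall i, trig_poly (F i)) -> trig_poly (fun x => \sum_(i <- s) F i x).
Proof.
move=> tF; elim: s => [|i s IH].
  exists [::], (fun=> 0); apply/funext => x; by rewrite !big_nil.
rewrite (_ : (fun x => _) = fun x => F i x + \sum_(j <- s) F j x).
  exact: trig_polyD.
by apply/funext => x; rewrite big_cons.
Qed.

Lemma trig_polyM g h : trig_poly g -> trig_poly h ->
  trig_poly (fun x => g x * h x).
Proof.
move=> [s [c ->]] [s' [c' ->]].
rewrite (_ : (fun x => _) = fun x =>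
    \sum_(k <- s) \sum_(l <- s') (c k * c' l) * cexp (k + l) x).
  by apply: trig_poly_bigsum => k; exact: trig_poly_sum.
apply/funext => x; rewrite mulr_suml; apply: eq_bigr => k _.
by rewrite mulr_sumr; apply: eq_bigr => l _; rewrite cexpD; ring.
Qed.

Lemma trig_poly_cexp (k : 'rV[int]_d) : trig_poly (@cexp R d k).
Proof.
exists [:: k], (fun=> 1); apply/funext => x.
by rewrite big_cons big_nil addr0 mul1r.
Qed.

Lemma trig_poly_cst (c : R[i]) : trig_poly (fun _ : d.-tuple R => c).
Proof.
exists [:: 0], (fun=> c); apply/funext => x.
by rewrite big_cons big_nil addr0 cexp0 mulr1.
Qed.

Lemma trig_poly_conj h : trig_poly h -> trig_poly (fun x => (h x)^*%C).
Proof.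
move=> [s [c ->]].
rewrite (_ : (fun x => _) = fun x => \sum_(k <- s) (c k)^*%C * cexp (- k) x).
  exact: trig_poly_sum.
apply/funext => x; rewrite rmorph_sum; apply: eq_bigr => k _.
by rewrite rmorphM cexpN.
Qed.

Lemma periodicZ_trig_poly h : trig_poly h -> periodicZ h.
Proof.
move=> [s [c ->]] x k; apply: eq_bigr => l _; congr (_ * _).
rewrite !cexpE (_ : dotZ l (translate x k) =
    dotZ l x + (\sum_(i < d) l 0 i * k 0 i)%:~R).
  by rewrite ecircD ecirc_int mulr1.
rewrite /dotZ raddf_sum -big_split /=; apply: eq_bigr => i _.
by rewrite tnth_mktuple mulrDr intrM.
Qed.

(** Real values allow composition with [stepp n] and pointwise bounds; the Fourier coefficients
    remain complex. *)
Definition real_trig (p : d.-tuple R -> R) := trig_poly (fun x => (p x)%:C).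

Lemma real_trig_cst (c : R) : real_trig (fun _ => c).
Proof. exact: trig_poly_cst. Qed.

Lemma real_trigD p q : real_trig p -> real_trig q ->
  real_trig (fun x => p x + q x).
Proof.
move=> tp tq; rewrite /real_trig; under eq_fun do rewrite rmorphD.
exact: trig_polyD.
Qed.

Lemma real_trigM p q : real_trig p -> real_trig q ->
  real_trig (fun x => p x * q x).
Proof.
move=> tp tq; rewrite /real_trig; under eq_fun do rewrite rmorphM.
exact: trig_polyM.
Qed.

Lemma real_trigB p q : real_trig p -> real_trig q ->
  real_trig (fun x => p x - q x).
Proof.
move=> tp tq; apply: real_trigD => //.
by under eq_fun do rewrite -mulN1r; apply: real_trigM => //; exact: real_trig_cst.
Qed.

Lemma real_trigX p n : real_trig p -> real_trig (fun x => p x ^+ n).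
Proof.
move=> tp; elim: n => [|n IH]; first exact: real_trig_cst.
by under eq_fun do rewrite exprS; exact: real_trigM.
Qed.

Lemma real_trig_cos (i : 'I_d) (a : R) :
  real_trig (fun x => cos (2 * pi * (tnth x i - a))).
Proof.
pose e : 'rV[int]_d := delta_mx 0 i.
have dE (x : d.-tuple R) : dotZ e x = tnth x i.
  rewrite /dotZ (bigD1 i) //= big1 => [|j ji]; first by rewrite mxE !eqxx mul1r addr0.
  by rewrite mxE (negbTE ji) andbF mul0r.
rewrite /real_trig (_ : (fun x => _) = fun x =>
   2^-1%:C * (cexp e x * ecirc (- a) + (cexp e x * ecirc (- a))^*%C)).
  have t : trig_poly (fun x => cexp e x * ecirc (- a)).
    by apply: trig_polyM; [exact: trig_poly_cexp|exact: trig_poly_cst].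
  apply: trig_polyM; first exact: trig_poly_cst.
  by apply: trig_polyD => //; exact: trig_poly_conj.
apply/funext => x; rewrite cexpE dE -ecircD.
apply: eq_complexP; rewrite /= ?mul0r ?subrr ?mulr0 ?subr0 ?addr0 //.
lra.
Qed.

Lemma measurable_real_trig p : real_trig p -> measurable_fun setT p.
Proof. by move=> /bmeas_trig[]. Qed.

End trig_algebra.

Lemma ae_tnth01 {R : realType} {d : nat} (i : 'I_d) :
  {ae torus_measure d, forall x : d.-tuple R, 0 <= tnth x i < 1}.
Proof.
exists [set x | (~` `[0, 1[%classic) (tnth x i)]; split.
- rewrite -[X in measurable X]setTI.
  apply: (@measurable_tnth _ (measurableTypeR R) d i measurableT (~` `[0, 1[%classic)).
  exact: measurableC.
- by apply: torus_coord_null; [exact: measurableC|exact: uniform_prob_setC01].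
- by move=> x /= h; rewrite in_itv.
Qed.

Section density.
Context {R : realType} {d : nat} (w : d.-tuple R -> R).
Context (mw : measurable_fun setT w) (w0 : forall x, 0 <= w x).
Context (wfin : (\int[torus_measure d]_x (w x)%:E < +oo)%E).
Local Notation lam := (@torus_measure R d).
Implicit Types g h p : d.-tuple R -> R.

Local Notation wint g := (\int[lam]_x (g x * w x)%:E)%E.

Lemma wint_le g h : measurable_fun setT g -> measurable_fun setT h ->
  (forall x, 0 <= g x <= h x) -> (wint g <= wint h)%E.
Proof.
move=> mg mh gh; apply: ge0_le_integral => //.
- by move=> x _; rewrite lee_fin mulr_ge0 //; case/andP: (gh x).
- by apply/measurable_EFinP; exact: measurable_funM.
- by apply/measurable_EFinP; exact: measurable_funM.
- by move=> x _; rewrite lee_fin ler_wpM2r //; case/andP: (gh x).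
Qed.

Lemma wintD g h : measurable_fun setT g -> measurable_fun setT h ->
  (forall x, 0 <= g x) -> (forall x, 0 <= h x) ->
  (wint (fun x => (g x + h x)%R) = wint g + wint h)%E.
Proof.
move=> mg mh g0 h0; under eq_integral do rewrite mulrDl EFinD.
rewrite ge0_integralD //.
- by move=> x _; rewrite lee_fin mulr_ge0.
- by apply/measurable_EFinP; exact: measurable_funM.
- by move=> x _; rewrite lee_fin mulr_ge0.
- by apply/measurable_EFinP; exact: measurable_funM.
Qed.

Lemma wintZ g (c : R) : measurable_fun setT g -> (forall x, 0 <= g x) ->
  0 <= c -> (wint (fun x => (c * g x)%R) = c%:E * wint g)%E.
Proof.
move=> mg g0 c0; under eq_integral do rewrite -mulrA EFinM.
rewrite ge0_integralZl //.
- by apply/measurable_EFinP; exact: measurable_funM.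
- by move=> x _; rewrite lee_fin mulr_ge0.
Qed.

Lemma wint_dominated (g : nat -> d.-tuple R -> R) G :
  (forall n, measurable_fun setT (g n)) -> measurable_fun setT G ->
  (forall n x, 0 <= g n x <= G x) -> (wint G < +oo)%E ->
  {ae lam, forall x, g n x @[n --> \oo] --> (0 : R)} ->
  wint (g n) @[n --> \oo] --> 0%E.
Proof.
move=> mg mG gG fG g0.
have [|||||_ _] := @dominated_convergence _ _ _ lam setT measurableT
   (fun n x => (g n x * w x)%:E) (cst 0%E) (fun x => (G x * w x)%:E).
- by move=> n; apply/measurable_EFinP; exact: measurable_funM.
- exact: measurable_cst.
- apply: filterS g0 => x gx _; apply: cvg_EFin; first exact: nearW.
  rewrite -[X in _ --> X](mul0r (w x)).
  by apply: cvgM => //; exact: cvg_cst.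
- apply/integrableP; split.
    by apply/measurable_EFinP; exact: measurable_funM.
  under eq_integral => x _.
    rewrite gee0_abs; last first.
      by rewrite lee_fin mulr_ge0 //; case/andP: (gG 0%N x) => /le_trans; apply.
    over.
  exact: fG.
- apply: nearW => x n _; have /andP[? ?] := gG n x.
  by rewrite gee0_abs ?lee_fin ?mulr_ge0 // ler_wpM2r.
by rewrite integral_cst // mul0e.
Qed.

Lemma wint1_fin : (wint (fun=> 1%R) < +oo)%E.
Proof. by under eq_integral do rewrite mul1r. Qed.

(* Sets approximable in L^1(w) by trigonometric polynomials with values in
   [0, 1]; the bounds make this a sigma-algebra. *)
Let approx_set : set (set (d.-tuple R)) := [set B | measurable B /\
  forall e : R, 0 < e -> exists p, [/\ real_trig p,
    forall x, 0 <= p x <= 1 &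
    (wint (fun x => `|\1_B x - p x|%R) < e%:E)%E]].

Let m_indic_sub B p : measurable B -> real_trig p ->
  measurable_fun setT (fun x => `|\1_B x - p x|).
Proof.
move=> mB tp; apply: measurableT_comp => //; apply: measurable_funB.
  exact: measurable_indic.
exact: measurable_real_trig.
Qed.

Let approx_setC B : approx_set B -> approx_set (~` B).
Proof.
move=> [mB aB]; split; first exact: measurableC.
move=> e /aB[p [tp p01 pe]]; exists (fun x => 1 - p x); split.
- by apply: real_trigB => //; exact: real_trig_cst.
- by move=> x; have := p01 x; lra.
- apply: le_lt_trans pe; apply: wint_le.
  + apply: m_indic_sub; first exact: measurableC.
    by apply: real_trigB => //; exact: real_trig_cst.
  + exact: m_indic_sub.
  + move=> x; rewrite normr_ge0 /= indicC /= indicE -(normrN (_ - p x)).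
    by rewrite (_ : _ - (_ - _) = - ((x \in B)%:R - p x)) //; case: (x \in B) => /=; ring.
Qed.

Let approx_setU A B : approx_set A -> approx_set B -> approx_set (A `|` B).
Proof.
move=> [mA aA] [mB aB]; split; first exact: measurableU.
move=> e e0; have e2 : 0 < e / 2 by rewrite divr_gt0.
have [p [tp p01 pe]] := aA _ e2; have [q [tq q01 qe]] := aB _ e2.
(* This is 1 - (1 - p)(1 - q): it stays in [0, 1], and the same formula links the indicators of [A],
   [B] and their union. *)
have tpq : real_trig (fun x => p x + q x - p x * q x).
  by apply: real_trigB; [exact: real_trigD|exact: real_trigM].
exists (fun x => p x + q x - p x * q x); split => //.
- by move=> x; have := p01 x; have := q01 x; nra.
rewrite [e]splitr EFinD.
apply: le_lt_trans (lteD pe qe); rewrite -wintD //; try exact: m_indic_sub.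
apply: wint_le.
- by apply: m_indic_sub => //; exact: measurableU.
- by apply: measurable_funD; exact: m_indic_sub.
move=> x; rewrite normr_ge0 /=.
have -> : \1_(A `|` B) x = \1_A x + \1_B x - \1_A x * \1_B x :> R.
  rewrite !indicE in_setU; case: (x \in A); case: (x \in B) => /=; ring.
have [a0 a1] : 0 <= \1_A x :> R /\ \1_A x <= 1 :> R.
  by rewrite indicE; case: (x \in A).
(* Each of the two errors comes with a factor in [0, 1], so the total is at most their sum. *)
rewrite (_ : _ - _ = (\1_A x - p x) * (1 - q x) +
  (\1_B x - q x) * (1 - \1_A x)); last by ring.
apply: (le_trans (ler_normD _ _)); rewrite !normrM.
have /andP[? ?] := q01 x.
by rewrite lerD // ler_piMr // ger0_norm; lra.
Qed.

Lemma indic_bigcup_cvg (A : nat -> set (d.-tuple R)) x :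
  `|\1_(\bigcup_k A k) x - \1_(\big[setU/set0]_(k < n) A k) x| @[n --> \oo]
    --> (0 : R).
Proof.
have [[k _ Akx]|nAx] := pselect ((\bigcup_k A k) x).
  apply: cvg_near_cst; near=> n.
  have kn : (k < n)%N by near: n; exact: nbhs_infty_gt.
  rewrite !indicE !mem_set ?subrr ?normr0 //; last by exists k.
  by rewrite -bigcup_mkord; exists k.
apply: cvg_near_cst; apply: nearW => n.
rewrite !indicE !memNset ?subrr ?normr0 //.
by rewrite -bigcup_mkord => -[k _ Akx]; apply: nAx; exists k.
Unshelve. all: by end_near.
Qed.

Let approx_set_bigcup (A : nat -> set (d.-tuple R)) :
  (forall n, approx_set (A n)) -> approx_set (\bigcup_k A k).
Proof.
move=> aA; have mA n : measurable (A n) by case: (aA n).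
have mU : measurable (\bigcup_k A k) by exact: bigcupT_measurable.
split=> // e e0; have e2 : 0 < e / 2 by rewrite divr_gt0.
pose U n := \big[setU/set0]_(k < n) A k.
have aU n : approx_set (U n).
  rewrite /U; elim: n => [|n IH]; last by rewrite big_ord_recr; exact: approx_setU.
  rewrite big_ord0; split=> // e' e'0; exists (fun=> 0); split => //.
  - exact: real_trig_cst.
  - by move=> x; rewrite lexx ler01.
  under eq_integral do rewrite indic0 subrr normr0 mul0r.
  by rewrite integral_cst // mul0e lte_fin.
have mD n : measurable_fun setT (fun x => `|\1_(\bigcup_k A k) x - \1_(U n) x| : R).
  apply: measurableT_comp => //; apply: measurable_funB; apply: measurable_indic => //.
  by case: (aU n).
have cU : wint (fun x => `|\1_(\bigcup_k A k) x - \1_(U n) x|) @[n --> \oo] --> 0%E.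
  apply: (@wint_dominated _ (fun=> 1)) => //.
  - move=> n x; rewrite normr_ge0 /= !indicE.
    by case: (x \in _); case: (x \in _);
      rewrite ?subrr ?subr0 ?sub0r ?normrN ?normr0 ?normr1.
  - exact: wint1_fin.
  - by apply: nearW => x; exact: indic_bigcup_cvg.
have [n Un] : exists n,
    (wint (fun x => `|\1_(\bigcup_k A k) x - \1_(U n) x|%R) < (e / 2)%:E)%E.
  have [|n _ Hn] := cU [set y | (y < (e / 2)%:E)%E].
    by apply: open_nbhs_nbhs; split; [exact: open_ereal_lt_ereal|rewrite /= lte_fin].
  by exists n; apply: Hn => /=.
have [mUn /(_ _ e2)[p [tp p01 pe]]] := aU n.
exists p; split => //; rewrite [e]splitr EFinD.
apply: le_lt_trans (lteD Un pe); rewrite -wintD //; last exact: m_indic_sub.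
apply: wint_le.
- exact: m_indic_sub.
- by apply: measurable_funD => //; exact: m_indic_sub.
by move=> x; rewrite normr_ge0 /= ler_distD.
Qed.

Let approx_setT : approx_set setT.
Proof.
rewrite -setC0; apply: approx_setC; split=> // e e0; exists (fun=> 0); split.
- exact: real_trig_cst.
- by move=> x; rewrite lexx ler01.
under eq_integral do rewrite indic0 subrr normr0 mul0r.
by rewrite integral_cst // mul0e lte_fin.
Qed.

Let approx_set_sigma : sigma_algebra setT approx_set.
Proof.
split.
- by rewrite -setCT; apply: approx_setC; exact: approx_setT.
- by move=> A aA; rewrite setTD; exact: approx_setC.
- exact: approx_set_bigcup.
Qed.

Let approx_set_halfspace (i : 'I_d) (a : R) :
  approx_set [set x | a < tnth x i].
Proof.
have mB : measurable [set x : d.-tuple R | a < tnth x i].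
  rewrite -[X in measurable X]setTI.
  rewrite (_ : [set x : d.-tuple R | a < tnth x i] =
    (@tnth _ (measurableTypeR R))^~ i @^-1` `]a, +oo[); last first.
    by apply/seteqP; split=> x; rewrite /= in_itv /= andbT.
  exact: measurable_tnth.
split=> // e e0.
have small p : real_trig p -> (forall x, 0 <= p x <= 1) ->
   {ae lam, forall x, \1_[set x | a < tnth x i] x - p x = 0} ->
   (wint (fun x => `|\1_[set x | a < tnth x i] x - p x|) < e%:E)%E.
  move=> tp _ h; rewrite (@ae_eq_integral _ _ _ lam setT (cst 0%E)) //.
  - by rewrite integral_cst // mul0e lte_fin.
  - by apply/measurable_EFinP; apply: measurable_funM => //; exact: m_indic_sub.
  - by apply: filterS h => x -> _; rewrite normr0 mul0r.
(* Almost every point has its coordinates in [0, 1[, so outside 0 <= a < 1 the half-space is almost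
   everything or almost nothing and a constant suffices. *)
have [a0|a0] := ltP a 0.
  exists (fun=> 1); split; first exact: real_trig_cst.
    by move=> x; rewrite lexx ler01.
  apply: small; [exact: real_trig_cst|by move=> x; rewrite lexx ler01|].
  apply: filterS (ae_tnth01 i) => x /andP[x0 _].
  by rewrite indicE mem_set ?subrr //=; exact: lt_le_trans x0.
have [a1|a1] := leP 1 a.
  exists (fun=> 0); split; first exact: real_trig_cst.
    by move=> x; rewrite lexx ler01.
  apply: small; [exact: real_trig_cst|by move=> x; rewrite lexx ler01|].
  apply: filterS (ae_tnth01 i) => x /andP[_ x1].
  rewrite indicE memNset ?subrr //=; apply/negP; rewrite -leNgt.
  by rewrite (le_trans (ltW x1)).
(* By [cos_arcE], [y] is below 1/2 exactly on the half-space, up to a null set. The factor 1/4 keeps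
   [y] in [0, 1], since two cosines differ by at most 2. *)
pose y (x : d.-tuple R) :=
  2^-1 + 4^-1 * (cos (2 * pi * (tnth x i - a / 2)) - cos (pi * a)).
have y01 x : 0 <= y x <= 1.
  have := cos_max (2 * pi * (tnth x i - a / 2)); have := cos_max (pi * a).
  by rewrite /y !ler_norml; lra.
have ty : real_trig y.
  apply: real_trigD; first exact: real_trig_cst.
  apply: real_trigM; first exact: real_trig_cst.
  by apply: real_trigB; [exact: real_trig_cos|exact: real_trig_cst].
have tp n : real_trig (fun x => stepp n (y x)).
  apply: real_trigX; apply: real_trigB; first exact: real_trig_cst.
  exact: real_trigX.
have : wint (fun x => `|\1_[set x | a < tnth x i] x - stepp n (y x)|)
    @[n --> \oo] --> 0%E.
  apply: (@wint_dominated _ (fun=> 1)) => //.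
  - by move=> n; exact: m_indic_sub.
  - move=> n x; rewrite normr_ge0 /= indicE.
    have := stepp01 n (y01 x).
    by case: (x \in _) => /=; rewrite ler_norml; lra.
  - exact: wint1_fin.
  - apply: filterS (ae_tnth01 i) => x x01.
    rewrite -(@normr0 _ R) -(subrr (\1_[set x | a < tnth x i] x)).
    apply: cvg_norm; apply: cvgB; first exact: cvg_cst.
    have := cvg_stepp (y01 x); rewrite (_ : (y x < 2^-1) = (a < tnth x i)); last first.
      rewrite -cos_arcE ?a0 // /y; apply/idP/idP; lra.
    rewrite indicE; case: (boolP (a < tnth x i)) => h.
      by rewrite mem_set.
    by rewrite memNset //; exact/negP.
move=> /(_ [set y | (y < e%:E)%E])[].
  by apply: open_nbhs_nbhs; split; [exact: open_ereal_lt_ereal|rewrite /= lte_fin].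
move=> n _ Hn; exists (fun x => stepp n (y x)); split => //.
  by move=> x; exact: stepp01.
by apply: (Hn n) => /=.
Qed.

(** Half-spaces generate the Borel sets, so the identity is measurable from the sigma-algebra
    [approx_set] to the Borel one. *)
Lemma approx_setP B : measurable B -> approx_set B.
Proof.
move=> mB.
pose T' := g_sigma_algebraType approx_set.
have mid : measurable_fun [set: T'] (id : T' -> d.-tuple (measurableTypeR R)).
  apply/measurable_fun_tnthP => i.
  apply: (measurability _ (RGenOInfty.measurableE R)).
  move=> _ [_ [a ->] <-]; rewrite setTI.
  rewrite measurable_g_measurableTypeE //.
  rewrite (_ : _ @^-1` _ = [set x | a < tnth x i]) //.
  by apply/seteqP; split=> x; rewrite /= in_itv /= andbT.
have := mid measurableT _ mB; rewrite setTI preimage_id.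
by rewrite measurable_g_measurableTypeE.
Qed.

Let wapprox h := forall e : R, 0 < e -> exists2 p, real_trig p &
  (wint (fun x => (h x - p x)%R ^+ 2) < e%:E)%E.

Let m_sqr_sub h p : measurable_fun setT h -> measurable_fun setT p ->
  measurable_fun setT (fun x => (h x - p x) ^+ 2).
Proof. by move=> mh mp; apply: measurable_funX; exact: measurable_funB. Qed.

Let wapprox_lim h : measurable_fun setT h ->
  (forall e : R, 0 < e -> exists g, [/\ measurable_fun setT g, wapprox g &
     (wint (fun x => (h x - g x)%R ^+ 2) < e%:E)%E]) -> wapprox h.
Proof.
(* The inequality (a + b)^2 <= 2 a^2 + 2 b^2 costs a factor 2, and e = 2 (e/4 + e/4). *)
move=> mh H e e0; have e4 : 0 < e / 4 by rewrite divr_gt0.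
have [g [mg ag hg]] := H _ e4; have [p tp gp] := ag _ e4.
exists p => //; have mp := measurable_real_trig tp.
apply: (@le_lt_trans _ _ (wint (fun x => 2 * ((h x - g x) ^+ 2 + (g x - p x) ^+ 2)))).
  apply: wint_le; first exact: m_sqr_sub.
    by apply: measurable_funM => //; apply: measurable_funD; exact: m_sqr_sub.
  move=> x; rewrite sqr_ge0 /=; have := sqr_ge0 ((h x - g x) - (g x - p x)); nra.
rewrite wintZ //; first last.
- by move=> x; rewrite addr_ge0 // sqr_ge0.
- by apply: measurable_funD; exact: m_sqr_sub.
rewrite wintD //; last 4 first.
- exact: m_sqr_sub.
- exact: m_sqr_sub.
- by move=> x; exact: sqr_ge0.
- by move=> x; exact: sqr_ge0.
rewrite (_ : e = 2 * (e / 4 + e / 4)); last by field.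
by rewrite EFinM lte_pmul2l // EFinD; exact: lteD.
Qed.

Let wapproxD g h : measurable_fun setT g -> measurable_fun setT h ->
  wapprox g -> wapprox h -> wapprox (fun x => g x + h x).
Proof.
move=> mg mh ag ah e e0; have e4 : 0 < e / 4 by rewrite divr_gt0.
have [p tp gp] := ag _ e4; have [q tq hq] := ah _ e4.
exists (fun x => p x + q x); first exact: real_trigD.
have mp := measurable_real_trig tp; have mq := measurable_real_trig tq.
apply: (@le_lt_trans _ _ (wint (fun x => 2 * ((g x - p x) ^+ 2 + (h x - q x) ^+ 2)))).
  apply: wint_le.
  - by apply: m_sqr_sub; exact: measurable_funD.
  - by apply: measurable_funM => //; apply: measurable_funD; exact: m_sqr_sub.
  move=> x; rewrite sqr_ge0 /=; have := sqr_ge0 ((g x - p x) - (h x - q x)); nra.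
rewrite wintZ //; first last.
- by move=> x; rewrite addr_ge0 // sqr_ge0.
- by apply: measurable_funD; exact: m_sqr_sub.
rewrite wintD //; last 4 first.
- exact: m_sqr_sub.
- exact: m_sqr_sub.
- by move=> x; exact: sqr_ge0.
- by move=> x; exact: sqr_ge0.
rewrite (_ : e = 2 * (e / 4 + e / 4)); last by field.
by rewrite EFinM lte_pmul2l // EFinD; exact: lteD.
Qed.

Let wapproxZ h c : measurable_fun setT h -> wapprox h -> wapprox (fun x => c * h x).
Proof.
(* The bound uses c^2 + 1 in place of c^2 so that c = 0 needs no separate case. *)
move=> mh ah e e0; have c1 : 0 < c ^+ 2 + 1 by rewrite ltr_wpDl // sqr_ge0.
have ec : 0 < e / (c ^+ 2 + 1) by rewrite divr_gt0.
have [p tp hp] := ah _ ec; have mp := measurable_real_trig tp.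
exists (fun x => c * p x); first by apply: real_trigM => //; exact: real_trig_cst.
apply: (@le_lt_trans _ _ (wint (fun x => (c ^+ 2 + 1) * (h x - p x) ^+ 2))).
  apply: wint_le.
  - by apply: m_sqr_sub; exact: measurable_funM.
  - by apply: measurable_funM => //; exact: m_sqr_sub.
  move=> x; rewrite sqr_ge0 /= -mulrBr exprMn.
  by rewrite ler_wpM2r ?sqr_ge0 // lerDl.
rewrite wintZ //; first last.
- exact: ltW.
- by move=> x; exact: sqr_ge0.
- exact: m_sqr_sub.
rewrite (_ : e = (c ^+ 2 + 1) * (e / (c ^+ 2 + 1))); last first.
  by rewrite mulrC divfK // gt_eqF.
by rewrite EFinM lte_pmul2l.
Qed.

(** The error of a [0, 1]-valued approximation of an indicator is at most 1, so its square is at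
    most its absolute value and the L^1 bound yields the L^2 bound. *)
Let wapprox_indic B : measurable B -> wapprox (\1_B).
Proof.
move=> mB e e0; have [_ /(_ _ e0)[p [tp p01 pe]]] := approx_setP mB.
exists p => //; have mp := measurable_real_trig tp.
apply: le_lt_trans pe; apply: wint_le.
- by apply: m_sqr_sub => //; exact: measurable_indic.
- exact: m_indic_sub.
move=> x; rewrite sqr_ge0 /= -real_normK ?num_real // expr2 ler_piMr //.
have := p01 x; rewrite indicE ler_norml; case: (x \in B) => /=; lra.
Qed.

Let wapprox_sum (I : Type) (s : seq I) (F : I -> d.-tuple R -> R) :
  (forall i, measurable_fun setT (F i)) -> (forall i, wapprox (F i)) ->
  wapprox (fun x => \sum_(i <- s) F i x).
Proof.
move=> mF aF; elim: s => [|i s IH]; last first.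
  under eq_fun do rewrite big_cons; apply: wapproxD => //.
  exact: measurable_sum.
move=> e e0; exists (fun=> 0); first exact: real_trig_cst.
under eq_integral do rewrite big_nil subrr expr0n mul0r.
by rewrite integral_cst // mul0e lte_fin.
Qed.

Import HBNNSimple.

Let wapprox_nnsfun (s : {nnsfun d.-tuple R >-> R}) : wapprox s.
Proof.
have -> : (s : _ -> _) = fun x =>
    \sum_(y <- finmap.enum_fset (fset_set (range s))) y * \1_(s @^-1` [set y]) x.
  by apply/funext => x; rewrite {1}fimfunE fsbig_finite.
have mP y : measurable (s @^-1` [set y]).
  exact: measurable_sfunP.
apply: wapprox_sum => y; first by apply: measurable_funM => //; exact: measurable_indic.
by apply: wapproxZ; [exact: measurable_indic|exact: wapprox_indic].
Qed.

(** Simple functions [s n] increase to [h], and the squared errors are dominated by h^2. *)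
Let wapprox_ge0 h : measurable_fun setT h -> (forall x, 0 <= h x) ->
  (wint (fun x => h x ^+ 2) < +oo)%E -> wapprox h.
Proof.
move=> mh h0 hfin; apply: wapprox_lim => // e e0.
have mEh : measurable_fun setT (EFin \o h) by exact/measurable_EFinP.
pose s := nnsfun_approx measurableT mEh.
have cs x : s n x @[n --> \oo] --> h x.
  have := @cvg_nnsfun_approx _ _ _ _ measurableT _ mEh (fun x _ => h0 x) x I.
  by move/fine_cvgP => [].
have sh n x : s n x <= h x.
  have nd : nondecreasing_seq (fun n => s n x).
    by move=> a b ab; exact/lefP/nd_nnsfun_approx.
  rewrite -(cvg_lim _ (cs x)) //; apply: nondecreasing_cvgn_le => //.
  exact: cvgP (cs x).
have c0 : wint (fun x => (h x - s n x) ^+ 2) @[n --> \oo] --> 0%E.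
  apply: (@wint_dominated _ (fun x => h x ^+ 2)) => //.
  - by move=> n; exact: m_sqr_sub.
  - exact: measurable_funX.
  - move=> n x; rewrite sqr_ge0 /=; have := sh n x; have : 0 <= s n x by [].
    by have := h0 x; nra.
  - apply: nearW => x.
    have c : h x - s n x @[n --> \oo] --> h x - h x.
      by apply: cvgB => //; exact: cvg_cst.
    by have := cvgM c c; rewrite subrr mulr0; exact.
have [|n _ Hn] := c0 [set y | (y < e%:E)%E].
  by apply: open_nbhs_nbhs; split; [exact: open_ereal_lt_ereal|rewrite /= lte_fin].
have Hnn := Hn n (leqnn n).
by exists (s n); split; [|exact: wapprox_nnsfun|exact: Hnn].
Qed.

Lemma real_trig_dense h : measurable_fun setT h ->
  (wint (fun x => h x ^+ 2) < +oo)%E ->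
  forall e : R, 0 < e -> exists2 p, real_trig p &
  (wint (fun x => (h x - p x)%R ^+ 2) < e%:E)%E.
Proof.
move=> mh hfin.
pose hp x := Num.max (h x) 0; pose hn x := Num.max (- h x) 0.
have hE : h = fun x => hp x + (-1) * hn x.
  apply/funext => x; rewrite /hp /hn.
  by case: (lerP (h x) 0) => ?; case: (lerP (- h x) 0) => ?; lra.
have mhp : measurable_fun setT hp by exact: measurable_maxr.
have mhn : measurable_fun setT hn.
  by apply: measurable_maxr => //; exact: measurableT_comp.
have sq g : (forall x, 0 <= g x ^+ 2 <= h x ^+ 2) -> measurable_fun setT g ->
    (wint (fun x => g x ^+ 2) < +oo)%E.
  move=> gh mg; apply: le_lt_trans hfin; apply: wint_le => //; exact: measurable_funX.
rewrite {1}hE; apply: wapproxD => //; first exact: measurable_funM.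
  apply: wapprox_ge0 => //; first by move=> x; rewrite /hp le_max lexx orbT.
  by apply: sq => // x; rewrite sqr_ge0 /hp /=; case: (lerP (h x) 0) => ?; nra.
apply: wapproxZ => //.
apply: wapprox_ge0 => //; first by move=> x; rewrite /hn le_max lexx orbT.
by apply: sq => // x; rewrite sqr_ge0 /hn /=; case: (lerP (- h x) 0) => ?; nra.
Qed.

Lemma trig_poly_dense (h : d.-tuple R -> R[i]) :
  measurable_fun setT (fun x => complex.Re (h x)) ->
  measurable_fun setT (fun x => complex.Im (h x)) ->
  (wint (fun x => sqn (h x)) < +oo)%E ->
  forall e : R, 0 < e -> exists2 p, trig_poly p &
  (wint (fun x => sqn (h x - p x)%R) < e%:E)%E.
Proof.
move=> mr mi hfin e e0; have e2 : 0 < e / 2 by rewrite divr_gt0.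
have fr : (wint (fun x => complex.Re (h x) ^+ 2) < +oo)%E.
  apply: le_lt_trans hfin; apply: wint_le; first exact: measurable_funX.
    exact: measurable_sqn_comp.
  by move=> x; rewrite sqr_ge0 lerDl sqr_ge0.
have fi : (wint (fun x => complex.Im (h x) ^+ 2) < +oo)%E.
  apply: le_lt_trans hfin; apply: wint_le; first exact: measurable_funX.
    exact: measurable_sqn_comp.
  by move=> x; rewrite sqr_ge0 lerDr sqr_ge0.
have [p tp pe] := real_trig_dense mr fr e2.
have [q tq qe] := real_trig_dense mi fi e2.
exists (fun x => (p x)%:C + (0 +i* 1) * (q x)%:C).
  by apply: trig_polyD => //; apply: trig_polyM => //; exact: trig_poly_cst.
rewrite [e]splitr EFinD; apply: le_lt_trans (lteD pe qe).
have mp := measurable_real_trig tp; have mq := measurable_real_trig tq.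
rewrite -wintD; last 4 first.
- exact: m_sqr_sub.
- exact: m_sqr_sub.
- by move=> x; exact: sqr_ge0.
- by move=> x; exact: sqr_ge0.
rewrite le_eqVlt; apply/orP; left; apply/eqP; apply: eq_integral => x _.
congr ((_ * _)%:E); rewrite /sqn ReD ImD ReN ImN ReD ImD ReM ImM /=.
ring.
Qed.

End density.

(** * Laws on configurations *)

Section configurations.
Context {d : nat}.
Local Notation Z := 'rV[int]_d.

Definition ones (s : seq Z) : set (config d) := all_ones [set` s].

Lemma ones_nil : ones [::] = setT.
Proof. by apply/seteqP; split. Qed.

Lemma ones_cat s t : ones (s ++ t) = ones s `&` ones t.
Proof.
apply/seteqP; split=> eta /=.
  by move=> h; split=> e es; apply: h; rewrite /= mem_cat es ?orbT.
by move=> [hs ht] e; rewrite /= mem_cat => /orP[/hs|/ht].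
Qed.

Lemma ones_eqi s t : s =i t -> ones s = ones t.
Proof.
by move=> st; apply/seteqP; split=> eta h e es; apply: h;
  rewrite /= ?st // -st.
Qed.

Lemma open_coord (e : Z) (b : bool) :
  open ([set eta | eta e = b] : set (config_space d)).
Proof.
rewrite (_ : [set eta | _] = (fun eta : config_space d => eta e) @^-1` [set b]) //.
apply: open_comp; last exact: discrete_open.
by move=> eta _; exact: (@proj_continuous _ (fun=> bool) e eta).
Qed.

Lemma open_ones s : open (ones s : set (config_space d)).
Proof.
elim: s => [|e s IH]; first by rewrite ones_nil; exact: openT.
rewrite (ones_cat [:: e] s); apply: openI => //.
rewrite (_ : ones _ = [set eta | eta e = true]); first exact: open_coord.
apply/seteqP; split=> eta /=; first by move=> h; apply: h; rewrite /= inE.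
by move=> h e'; rewrite /= inE => /eqP ->.
Qed.

Lemma open_onesC s : open (~` ones s : set (config_space d)).
Proof.
rewrite (_ : ~` _ = \bigcup_(e in [set` s]) [set eta : config_space d | eta e = false]).
  by apply: bigcup_open => e _; exact: open_coord.
apply/seteqP; split=> eta /=.
  move=> h; apply/not_exists2P => H; apply: h => e es.
  by have [//|] := H e; rewrite /=; case: (eta e).
by move=> [e es ee] /(_ _ es); rewrite ee.
Qed.

Lemma measurable_open_config (A : set (config d)) :
  open (A : set (config_space d)) -> measurable A.
Proof. exact: sub_sigma_algebra. Qed.

Lemma measurable_ones s : measurable (ones s).
Proof. by apply: measurable_open_config; exact: open_ones. Qed.

(** The event is open and closed; this is what carries its probability through a weak* limit. *)
Lemma continuous_indic_ones {R : realType} s :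
  continuous (\1_(ones s) : config_space d -> R).
Proof.
move=> eta; apply: cvg_near_cst.
have [h|h] := pselect (ones s eta).
  have : nbhs eta (ones s) by apply: open_nbhs_nbhs; split=> //; exact: open_ones.
  by apply: filterS => eta' h'; rewrite !indicE !mem_set.
have : nbhs eta (~` ones s) by apply: open_nbhs_nbhs; split=> //; exact: open_onesC.
by apply: filterS => eta' h'; rewrite !indicE !memNset.
Qed.

Let G : set (set (config d)) := [set A | exists s, A = ones s].
Let T' := g_sigma_algebraType G.

(** Sites are numbered by [pickle]. Splitting [A] by the state of the site numbered n leaves two
    sections that depend only on sites with smaller numbers. *)
Let measurable_depends n (A : set T') :
  (forall eta eta', (forall e : Z, (pickle e < n)%N -> eta e = eta' e) ->
    A eta -> A eta') -> measurable A.
Proof.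
elim: n A => [|n IH] A hA.
  have [[eta Aeta]|nA] := pselect (exists eta, A eta).
    rewrite (_ : A = setT) //; apply/seteqP; split=> // eta' _.
    exact: (hA eta).
  rewrite (_ : A = set0) //; apply/seteqP; split=> // eta Aeta.
  by apply: nA; exists eta.
have [[e en]|ne] := pselect (exists e : Z, pickle e = n); last first.
  apply: IH => eta eta' h; apply: hA => e; rewrite ltnS leq_eqVlt => /orP[/eqP|].
    by move=> en; case: ne; exists e.
  exact: h.
pose upd (b : bool) (eta : Z -> bool) : Z -> bool :=
  fun e' => if e' == e then b else eta e'.
have mA b : measurable ([set eta | A (upd b eta)] : set T').
  apply: IH => eta eta' h; apply: hA => e'; rewrite /upd ltnS leq_eqVlt.
  case: (boolP (e' == e)) => // e'e /orP[/eqP e'n|]; last by move=> ?; exact: h.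
  by case/eqP: e'e; apply: (pcan_inj pickleK); rewrite e'n en.
have mE : measurable (ones [:: e] : set T').
  by apply: sub_sigma_algebra; exists [:: e].
have onesE1 eta : ones [:: e] eta <-> eta e = true.
  split=> [h|h e']; first by apply: h; rewrite /= inE.
  by rewrite /= inE => /eqP ->.
have updE eta : A eta <-> A (upd (eta e) eta).
  by split; apply: hA => e' _; rewrite /upd; case: eqP => // ->.
rewrite (_ : A = ([set eta | A (upd true eta)] `&` ones [:: e]) `|`
                 ([set eta | A (upd false eta)] `&` ~` ones [:: e])).
  by apply: measurableU; apply: measurableI => //; exact: measurableC.
apply/seteqP; split=> eta /=.
  move=> /updE; case E: (eta e) => h; [left|right]; split=> //; first exact/onesE1.
  by move=> /onesE1; rewrite E.
move=> [[h /onesE1 E]|[h nE]]; apply/updE; first by rewrite E.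
by case E: (eta e) => //; case: nE; apply/onesE1.
Qed.

(** Since Z^d is countable, an open set is a countable union of sets that depend on finitely many
    sites. *)
Lemma measurable_config_ones :
  (@measurable _ (config d)) = <<s [set A | exists s, A = ones s] >>.
Proof.
apply/seteqP; split; last first.
  apply: smallest_sub; first exact: sigma_algebra_measurable.
  by move=> _ [s ->]; exact: measurable_ones.
apply: smallest_sub; first exact: smallest_sigma_algebra.
move=> U oU.
pose V n : set T' := [set eta | forall eta', (forall e : Z, (pickle e < n)%N ->
   eta e = eta' e) -> U eta'].
rewrite (_ : U = \bigcup_n V n).
  suff : measurable (\bigcup_n V n) by [].
  apply: bigcupT_measurable => n; apply: (@measurable_depends n) => eta eta' h.
  by move=> hV eta'' h'; apply: hV => e en; rewrite h // h'.
apply/seteqP; split=> [eta Ueta|eta [n _]]; last by apply.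
apply: contrapT => nV0.
have nV n : ~ V n eta by move=> h; apply: nV0; exists n.
(* If no finite set of sites forced membership in [U], there would be configurations outside [U]
   agreeing with [eta] on ever more sites; they converge to [eta], against openness of [U]. *)
have /choice[u hu] n : exists eta', (forall e : Z, (pickle e < n)%N ->
    eta e = eta' e) /\ ~ U eta'.
  apply: contrapT => h; apply: (nV n) => eta' h'.
  by apply: contrapT => nU; apply: h; exists eta'.
have cu : {ptws, u @ \oo --> (eta : Z -> bool)}.
  apply/cvg_sup => e A [B [[C oC <-] Ce] BA].
  suff : \forall n \near \oo, A (u n) by [].
  exists (pickle e).+1 => // n en; apply: BA.
  by move: Ce; rewrite /= ((hu n).1 e).
have : \forall n \near \oo, U (u n).
  by apply: cu; apply: open_nbhs_nbhs.
by move=> [n _ /(_ n (leqnn n))] /=; exact: (hu n).2.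
Qed.

(** The events [ones s] form a pi-system that generates the Borel sets. Removing repetitions from
    [s] gives the distinct sites that the determinantal formula asks for. *)
Lemma same_law_ones {R : realType} (P Q : probability (config d) R) :
  (forall s, uniq s -> P (ones s) = Q (ones s)) -> same_law P Q.
Proof.
move=> h A mA.
apply: (measure_unique [set A | exists s, A = ones s] (fun=> setT)) => //.
- exact: measurable_config_ones.
- by move=> _ _ [s ->] [t ->]; exists (s ++ t); rewrite ones_cat.
- by move=> _; exists [::]; rewrite ones_nil.
- by rewrite bigcup_const.
- move=> _ [s ->]; rewrite -(ones_eqi (mem_undup s)); apply: h; exact: undup_uniq.
- by move=> _; exact: fin_num_fun_lty.
Qed.

(** The configurations other than [all_zero d] are covered by countably many null events, one for
    each site. *)
Lemma same_law_dirac0 {R : realType} (Q : probability (config d) R) :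
  (forall e, Q (ones [:: e]) = 0%E) -> same_law Q (dirac (all_zero d)).
Proof.
move=> h A mA.
pose B n : set (config d) := [set eta | exists2 e : Z, pickle e = n & ones [:: e] eta].
have B0 n : measurable (B n) /\ Q (B n) = 0%E.
  have [[e en]|ne] := pselect (exists e : Z, pickle e = n).
    rewrite (_ : B n = ones [:: e]); first by split; [exact: measurable_ones|].
    apply/seteqP; split=> [eta [e' e'n]|eta ?]; last by exists e.
    by rewrite (_ : e' = e) //; apply: (pcan_inj pickleK); rewrite e'n en.
  rewrite (_ : B n = set0) ?measure0 //; apply/seteqP; split=> // eta [e en _].
  by apply: ne; exists e.
pose N := \bigcup_n B n.
have mN : measurable N by apply: bigcupT_measurable => n; case: (B0 n).
have N0 : Q N = 0%E.
  apply: measure_negligible => //; apply: negligible_bigcup => n.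
  by have [mB B0n] := B0 n; exists (B n); split.
have NE eta : eta <> all_zero d -> N eta.
  move=> ne; have [e ee] : exists e, eta e <> false.
    apply/existsNP => he; apply: ne; apply/funext => e; exact: he.
  exists (pickle e) => //; exists e => // e'; rewrite /= inE => /eqP ->.
  by case: (eta e) ee.
have sub0 C : measurable C -> C `<=` N -> Q C = 0%E.
  move=> mC CN; apply/eqP; rewrite eq_le measure_ge0 andbT -N0.
  by apply: le_measure; rewrite ?inE.
rewrite -[RHS]/(\1_A (all_zero d))%:E indicE; have [zA|zA] := boolP (all_zero d \in A).
  have : Q (~` A) = 0%E.
    apply: sub0; first exact: measurableC.
    by move=> eta nA; apply: NE => E; apply: nA; rewrite E; exact/set_mem.
  rewrite probability_setC // -(fineK (fin_num_measure Q A mA)) -EFinB.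
  by move=> [/eqP]; rewrite subr_eq0 => /eqP <-.
rewrite /= sub0 // => eta Aeta; apply: NE => E; move/negP: zA; apply.
by rewrite -E; exact/mem_set.
Qed.

Lemma finite_box n : finite_set (@box d n).
Proof.
pose f (v : 'rV['I_(n.*2.+1)]_d) : Z := \row_i ((v 0 i)%:Z - n%:Z).
apply: (@sub_finite_set _ _ (f @` setT)); last exact: finite_image.
move=> e /= he.
have ge0 i : (0 <= e 0 i + n%:Z)%R by have := he i; lia.
exists (\row_i inord `|(e 0 i + n%:Z)%R|%N) => //.
apply/rowP => i; rewrite !mxE inordK; last by have := he i; have := ge0 i; lia.
by have := ge0 i; lia.
Qed.

Lemma box_le m n : (m <= n)%N -> @box d m `<=` box n.
Proof. by move=> mn e he i; have := he i; lia. Qed.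

Lemma box_exists (e : Z) : exists n, box n e.
Proof.
exists (\sum_(i < d) `|e 0%R i|)%N => i.
by rewrite (bigD1 i) //=; lia.
Qed.

Lemma box_cover (s : seq Z) : exists n, forall e, e \in s -> box n e.
Proof.
elim: s => [|e s [n hn]]; first by exists 0%N.
have [m hm] := box_exists e; exists (maxn m n) => e'; rewrite inE => /orP[/eqP ->|es].
  by apply: box_le hm; exact: leq_maxl.
by apply: box_le (hn _ es); exact: leq_maxr.
Qed.

End configurations.

(** * Gram matrices and conditioning *)

Section schur.
Context {K : comUnitRingType}.

Lemma det_schur m p (A : 'M[K]_m) (B : 'M[K]_(m, p)) (C : 'M[K]_(p, m))
    (D : 'M[K]_p) : A \in unitmx ->
  \det (block_mx A B C D) = \det A * \det (D - C *m invmx A *m B).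
Proof.
move=> Au.
have -> : block_mx A B C D =
    block_mx 1%:M 0 (C *m invmx A) 1%:M *m block_mx A B 0 (D - C *m invmx A *m B).
  rewrite mulmx_block !mul1mx !mul0mx !addr0.
  by rewrite mulmxKV // [C *m _ *m B + _]addrC subrK.
by rewrite det_mulmx det_lblock det_ublock !det1 !mul1r.
Qed.

End schur.

Lemma conjcM {R : realType} (x y : R[i]) : (x * y)^*%C = x^*%C * y^*%C.
Proof. exact: rmorphM. Qed.

Section weighted_form.
Context {R : realType} {d : nat} (f : d.-tuple R -> R).
Context (f_meas : measurable_fun setT f) (f01 : forall x, 0 <= f x <= 1).
Local Notation X := (d.-tuple R).
Local Notation lam := (@torus_measure R d).
Implicit Types u v w : X -> R[i].

(** Only a semi-definite form, as [f] may vanish on a set of positive measure. The weight 1 gives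
    the ordinary L^2 product, used later beside it. *)
Definition ip u v : R[i] :=
  torus_cintegral (fun x => (f x)%:C * (u x * (v x)^*%C)).

Definition nrm2 u : R := \int[lam]_x (f x * sqn (u x)).

Let bmf : bmeas (fun x => (f x)%:C).
Proof.
apply: (@bmeas_real _ _ _ 1) => // x; have /andP[f0 f1] := f01 x.
by rewrite ger0_norm.
Qed.

Let bm_ip u v : bmeas u -> bmeas v -> bmeas (fun x => (f x)%:C * (u x * (v x)^*%C)).
Proof. by move=> bu bv; do 2 apply: bmeasM => //; exact: bmeas_conj. Qed.

Lemma ipB u v w : bmeas u -> bmeas v -> bmeas w ->
  ip (fun x => u x - v x) w = ip u w - ip v w.
Proof.
move=> bu bv bw; rewrite /ip -cintB; [|exact: bm_ip|exact: bm_ip].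
by congr torus_cintegral; apply/funext => x; ring.
Qed.

Lemma ipZ c u v : bmeas u -> bmeas v -> ip (fun x => c * u x) v = c * ip u v.
Proof.
move=> bu bv; rewrite /ip -cintZ; last exact: bm_ip.
by congr torus_cintegral; apply/funext => x; ring.
Qed.

Lemma ip_sum (I : Type) (s : seq I) (c : I -> R[i]) (F : I -> X -> R[i]) v :
  (forall i, bmeas (F i)) -> bmeas v ->
  ip (fun x => \sum_(i <- s) c i * F i x) v = \sum_(i <- s) c i * ip (F i) v.
Proof.
move=> bF bv; have bc : bmeas (fun x => \sum_(i <- s) c i * F i x).
  by apply: bmeas_sum => i; apply: bmeasM => //; exact: bmeas_cst.
rewrite /ip (_ : (fun x => _) = fun x =>
    \sum_(i <- s) c i * ((f x)%:C * (F i x * (v x)^*%C))).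
  rewrite cint_sum; last by move=> i; apply: bmeasM; [exact: bmeas_cst|exact: bm_ip].
  by apply: eq_bigr => i _; rewrite cintZ //; exact: bm_ip.
apply/funext => x; rewrite mulr_suml mulr_sumr; apply: eq_bigr => i _; ring.
Qed.

Lemma ip_conj u v : bmeas u -> bmeas v -> ip v u = (ip u v)^*%C.
Proof.
move=> bu bv; rewrite /ip -cint_conj; last exact: bm_ip.
congr torus_cintegral; apply/funext => x.
by rewrite !conjcM conjcK conjc_real; ring.
Qed.

Lemma ip_nrm2 u : bmeas u -> ip u u = (nrm2 u)%:C.
Proof.
move=> bu; rewrite /ip /nrm2; apply: eq_complexP => /=.
  by apply: eq_Rintegral => x _; rewrite mulc_conj /= mul0r subr0.
under eq_Rintegral => x _ do rewrite mulc_conj /= mul0r mulr0 addr0.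
by rewrite Rintegral_cst // mul0r.
Qed.

Lemma nrm2_ge0 u : 0 <= nrm2 u.
Proof.
apply: Rintegral_ge0 => x _; have /andP[? _] := f01 x.
by rewrite mulr_ge0 // sqn_ge0.
Qed.

Lemma nrm2_cexp_le1 (k : 'rV[int]_d) : nrm2 (cexp k) <= 1.
Proof.
have /bmeas_integrable[fi _] := bmf.
rewrite /nrm2; under eq_Rintegral => x _ do rewrite sqn_cexp mulr1.
apply: (@le_trans _ _ (\int[lam]_x 1)).
  apply: le_Rintegral => //.
    have /bmeas_integrable[] := @bmeas_cst R d 1; by [].
  by move=> x _; have /andP[] := f01 x.
rewrite Rintegral_cst //.
have -> : fine (torus_measure d setT) = 1 :> R by rewrite probability_setT.
by rewrite mulr1.
Qed.

Lemma nrm2_sub u v : bmeas u -> bmeas v ->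
  nrm2 (fun x => u x - v x) = nrm2 u - complex.Re (ip u v) *+ 2 + nrm2 v.
Proof.
move=> bu bv; have buv := bmeasB bu bv.
apply: complexI; rewrite -ip_nrm2 // ipB //.
rewrite (ip_conj buv bu) (ip_conj buv bv) !ipB // !ip_nrm2 //.
rewrite (ip_conj bu bv).
move: (ip u v) => [a b].
by apply: eq_complexP; rewrite /= ?mulr2n; ring.
Qed.

Lemma ip_cauchy_schwarz u v : bmeas u -> bmeas v ->
  sqn (ip u v) <= nrm2 u * nrm2 v.
Proof.
move=> bu bv; set z := ip u v.
(* This is the squared norm of u - t z v; the factor [z] aligns the phases, leaving a real quadratic
   in [t]. *)
have H (t : R) : 0 <= nrm2 u - 2 * t * sqn z + t ^+ 2 * sqn z * nrm2 v.
  have bcv : bmeas (fun x => (t%:C * z) * v x).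
    by apply: bmeasM => //; exact: bmeas_cst.
  have := nrm2_ge0 (fun x => u x - (t%:C * z) * v x); rewrite nrm2_sub //.
  have -> : ip u (fun x => (t%:C * z) * v x) = (t * sqn z)%:C.
    rewrite (ip_conj bcv bu) ipZ // (ip_conj bu bv) -/z !conjcM conjcK conjc_real.
    rewrite -[_ * z^*%C * z]mulrA [z^*%C * z]mulrC mulc_conj.
    by apply: eq_complexP; rewrite /= ?mul0r ?mulr0 ?subr0 ?addr0.
  have -> : nrm2 (fun x => (t%:C * z) * v x) = t ^+ 2 * sqn z * nrm2 v.
    apply: complexI; rewrite -ip_nrm2 // ipZ // (ip_conj bcv bv) ipZ // conjcM.
    by rewrite ip_nrm2 // conjc_real mulrA mulc_conj sqnM sqn_real -rmorphM.
  by rewrite [complex.Re _ *+ 2](_ : _ = 2 * t * sqn z) //= mulr2n; ring.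
have u0 := nrm2_ge0 u; have v0 := nrm2_ge0 v; have z0 := sqn_ge0 z.
have [v00|vn0] := eqVneq (nrm2 v) 0.
  rewrite v00 mulr0 leNgt; apply/negP => zp.
  (* With [nrm2 v] equal to 0 the quadratic is affine in [t], and this [t] makes it - nrm2 u - 2. *)
  have := H ((nrm2 u + 1) / sqn z); rewrite v00 mulr0 addr0 -mulrA divfK ?gt_eqF //.
  by lra.
have vp : 0 < nrm2 v by rewrite lt_neqAle eq_sym vn0.
(* The minimiser of the quadratic. *)
have := H (nrm2 v)^-1.
rewrite [X in _ + X](_ : _ = (nrm2 v)^-1 * sqn z); last by field.
rewrite -mulrA [_ * sqn z]mulrC -(pmulr_lge0 _ vp).
rewrite [X in 0 <= X](_ : _ = nrm2 u * nrm2 v - sqn z); last by field.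
by rewrite subr_ge0.
Qed.

Lemma fourier_ip (k l : 'rV[int]_d) : fourier f (l - k) = ip (cexp k) (cexp l).
Proof.
rewrite /fourier /ip; congr torus_cintegral; apply/funext => x.
by rewrite opprB cexpD cexpN.
Qed.

End weighted_form.

Section conditioning.
Context {R : realType} {d : nat} (f : d.-tuple R -> R).
Context (f_meas : measurable_fun setT f) (f01 : forall x, 0 <= f x <= 1).
Context (P : probability (config d) R) (hP : determinantal f P).
Local Notation Z := 'rV[int]_d.
Local Notation ip := (ip f).

(** Includes k = 0, which [determinantal] leaves out: the collar of width 0 is empty, and so may be
    the list of sites. *)
Lemma det_all_ones k (e : 'I_k -> Z) : injective e ->
  (fine (P (all_ones (range e))))%:C =
  \det (\matrix_(i < k, j < k) ip (cexp (e i)) (cexp (e j))).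
Proof.
move=> ie; case: k e ie => [|k] e ie; last first.
  by rewrite (hP _ ie) //; congr (\det _); apply/matrixP => i j;
    rewrite !mxE fourier_ip.
rewrite det_mx00 (_ : all_ones (range e) = setT) ?probability_setT //.
by apply/seteqP; split=> // eta _ e' [[]].
Qed.

(* Conditioning on 1s on the range of [b] replaces the Gram matrix of the
   exponentials in L^2(f) by the Gram matrix of their components [e - u]
   orthogonal to the span of the exponentials indexed by [b]. *)
Lemma cond_det m p (b : 'I_m -> Z) (a : 'I_p -> Z) : injective b ->
  injective a -> (forall i j, b i <> a j) -> P (all_ones (range b)) != 0%E ->
  exists u : 'I_p -> d.-tuple R -> R[i],
  [/\ forall i, exists c : 'I_m -> R[i],
        u i = fun x => \sum_(l < m) c l * cexp (b l) x,
      forall i j, ip (fun x => cexp (a i) x - u i x) (cexp (b j)) = 0 &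
      (fine (P (all_ones (range a) `&` all_ones (range b))) /
       fine (P (all_ones (range b))))%:C =
      \det (\matrix_(i < p, j < p)
        ip (fun x => cexp (a i) x - u i x) (cexp (a j)))].
Proof.
move=> ib ia ab Pb.
pose KB := \matrix_(i < m, j < m) ip (cexp (b i)) (cexp (b j)).
pose KBA := \matrix_(i < m, j < p) ip (cexp (b i)) (cexp (a j)).
pose KAB := \matrix_(i < p, j < m) ip (cexp (a i)) (cexp (b j)).
pose KA := \matrix_(i < p, j < p) ip (cexp (a i)) (cexp (a j)).
have fPb : fine (P (all_ones (range b))) != 0.
  have mb : measurable (all_ones (range b)).
    rewrite (_ : all_ones _ = ones (codom b)); first exact: measurable_ones.
    apply/seteqP; split=> eta h e'; first by move=> /codomP[i ->]; apply: h; exists i.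
    by move=> [i _ <-]; apply: h; rewrite /= codom_f.
  apply: contra Pb => /eqP h; rewrite -[P _]fineK ?h //.
  exact: fin_num_measure.
(* The determinant of this Gram matrix is the probability of the conditioning event, assumed
   nonzero. *)
have uKB : KB \in unitmx.
  rewrite unitmxE unitfE -det_all_ones //.
  by apply: contra fPb => /eqP/complexI ->.
(* The solution of the normal equations [c *m KB = KAB]: row i holds the coefficients of the
   projection of the i-th exponential. *)
pose c := KAB *m invmx KB.
pose e (k : 'I_(m + p)) := match fintype.split k with inl i => b i | inr j => a j end.
have ie : injective e.
  move=> k k'; rewrite /e; case: (split_ordP k) => i ->; case: (split_ordP k') => j ->.
  - by move/ib ->.
  - by move=> /ab.
  - by move=> /esym/ab.
  - by move/ia ->.
have rE : all_ones (range e) = all_ones (range a) `&` all_ones (range b).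
  apply/seteqP; split=> eta.
    move=> h; split=> _ [i _ <-]; apply: h.
      by exists (rshift m i) => //; rewrite /e (unsplitK (inr i)).
    by exists (lshift p i) => //; rewrite /e (unsplitK (inl i)).
  move=> [ha hb] _ [k _ <-]; rewrite /e; case: (fintype.split k) => i.
    by apply: hb; exists i.
  by apply: ha; exists i.
have KE : \matrix_(i < m + p, j < m + p) ip (cexp (e i)) (cexp (e j)) =
    block_mx KB KBA KAB KA.
  apply/matrixP => i j; rewrite !mxE /e.
  by case: (fintype.split i) => i'; rewrite !mxE;
    case: (fintype.split j) => j'; rewrite !mxE.
pose u i (x : d.-tuple R) := \sum_(l < m) c i l * cexp (b l) x.
have bu i : bmeas (u i).
  by apply: bmeas_sum => l; apply: bmeasM; [exact: bmeas_cst|exact: bmeas_cexp].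
have ipu i k : ip (fun x => cexp (a i) x - u i x) (cexp k) =
    ip (cexp (a i)) (cexp k) - \sum_(l < m) c i l * ip (cexp (b l)) (cexp k).
  rewrite ipB ?ip_sum //; try exact: bmeas_cexp.
  by move=> ?; exact: bmeas_cexp.
exists u; split.
- by move=> i; exists (c i).
- move=> i j; rewrite ipu.
  have /matrixP/(_ i j) : c *m KB = KAB by rewrite /c mulmxKV.
  rewrite !mxE => <-; apply/eqP; rewrite subr_eq0; apply/eqP.
  by apply: eq_bigr => l _; rewrite !mxE.
rewrite -rE fmorph_div /= det_all_ones // det_all_ones // KE det_schur //.
rewrite mulrAC divff ?mul1r; last by rewrite -unitfE -unitmxE.
congr (\det _); apply/matrixP => i j; rewrite !mxE ipu; congr (_ - _).
by apply: eq_bigr => l _; rewrite !mxE.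
Qed.

End conditioning.

(** * Limits of conditioned measures *)

Section real_limits.
Context {R : realType}.

(** Applied with conditional probabilities for [s] and a real or imaginary part of a Fourier
    coefficient for [u]: the Cauchy property of [s] at scale e^2 gives that of [u] at scale e. *)
Lemma cvg_of_sqr_le (u s : nat -> R) (c : R) (K : nat) :
  s k @[k --> \oo] --> c ->
  (forall k l, (K <= k)%N -> (k <= l)%N -> (u k - u l) ^+ 2 <= s k - s l) ->
  cvgn u.
Proof.
move=> sc us; apply/cauchy_cvgP; apply: cauchy_exP => e e0.
have e2 : 0 < e ^+ 2 / 2 by rewrite divr_gt0 // exprn_gt0.
have /cvgrPdist_lt/(_ _ e2)[N _ HN] := sc.
pose M := maxn K N; exists (u M); exists M => // l /= Ml; rewrite /ball /=.
have := us M l (leq_maxl _ _) Ml.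
have := HN M (leq_maxr _ _); have := HN l (leq_trans (leq_maxr _ _) Ml).
rewrite /= !ltr_norml => /andP[a1 a2] /andP[b1 b2] H.
by apply/andP; split; nra.
Qed.

Lemma cvg_dist_le (u : nat -> R) (l a e : R) : u k @[k --> \oo] --> l ->
  (\forall k \near \oo, `|u k - a| <= e) -> `|l - a| <= e.
Proof.
move=> ul H; have c : `|u k - a| @[k --> \oo] --> `|l - a|.
  by apply: cvg_norm; apply: cvgB => //; exact: cvg_cst.
by rewrite -(cvg_lim _ c) //; apply: limr_le => //; exact: cvgP c.
Qed.

End real_limits.

Section det_continuity.
Context {R : realType}.
Local Notation C := R[i].

(** Continuity is phrased in squared moduli of the entries because Cauchy-Schwarz delivers bounds in
    that form. *)
Let cont (p : nat) (A : 'M[C]_p) (F : 'M[C]_p -> C) := forall e : R, 0 < e ->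
  exists2 r : R, 0 < r & forall M : 'M[C]_p, (forall i j, sqn (M i j - A i j) <= r) ->
    sqn (F M - F A) <= e.

Let contD p (A : 'M[C]_p) F G : cont A F -> cont A G ->
  cont A (fun M => F M + G M).
Proof.
move=> cF cG e e0; have e4 : 0 < e / 4 by rewrite divr_gt0.
have [r r0 hF] := cF _ e4; have [r' r'0 hG] := cG _ e4.
exists (Num.min r r'); first by rewrite lt_min r0.
move=> M hM; rewrite opprD addrACA; apply: (le_trans (sqnD_le _ _)).
have := hF M; have := hG M; move=> /(_ _)/wrap[|a].
  by move=> i j; apply: le_trans (hM i j) _; rewrite ge_min lexx orbT.
move=> /(_ _)/wrap[|b]; last by lra.
by move=> i j; apply: le_trans (hM i j) _; rewrite ge_min lexx.
Qed.

Let contM p (A : 'M[C]_p) F G : cont A F -> cont A G ->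
  cont A (fun M => F M * G M).
Proof.
(* [sqnD_le], used twice on the three-term expansion of the difference below, gives 4 yz + 4 az + 2
   yb with y, z <= t <= 1, which is at most t K. *)
move=> cF cG e e0; pose K := 4 + 4 * sqn (F A) + 2 * sqn (G A).
have a0 := sqn_ge0 (F A); have b0 := sqn_ge0 (G A).
have K0 : 0 < K by rewrite /K; lra.
pose t := Num.min 1 (e / K).
have t0 : 0 < t by rewrite lt_min ltr01 divr_gt0.
have t1 : t <= 1 by rewrite ge_min lexx.
have tK : t * K <= e by rewrite -ler_pdivlMr // ge_min lexx orbT.
have [r r0 hF] := cF _ t0; have [r' r'0 hG] := cG _ t0.
exists (Num.min r r'); first by rewrite lt_min r0.
move=> M hM.
have fM : sqn (F M - F A) <= t.
  by apply: hF => i j; apply: le_trans (hM i j) _; rewrite ge_min lexx.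
have gM : sqn (G M - G A) <= t.
  by apply: hG => i j; apply: le_trans (hM i j) _; rewrite ge_min lexx orbT.
rewrite (_ : F M * G M - F A * G A = ((F M - F A) * (G M - G A) +
  F A * (G M - G A)) + (F M - F A) * G A); last by ring.
apply: (le_trans (sqnD_le _ _)).
have := sqnD_le ((F M - F A) * (G M - G A)) (F A * (G M - G A)).
rewrite !sqnM; set x := sqn (_ + _).
have := sqn_ge0 (F M - F A); have := sqn_ge0 (G M - G A).
move: fM gM tK; rewrite /K.
set y := sqn (F M - F A); set z := sqn (G M - G A); move: x => x.
move: a0 b0; set a := sqn (F A); set b := sqn (G A) => *.
have : y * z <= t by nra.
have : a * z <= a * t by nra.
have : y * b <= t * b by nra.
lra.
Qed.

Let cont_cst p (A : 'M[C]_p) c : cont A (fun=> c).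
Proof. by move=> e e0; exists 1 => // M _; rewrite subrr sqn0 ltW. Qed.

Lemma det_continuous p (A : 'M[C]_p) (e : R) : 0 < e ->
  exists2 r : R, 0 < r & forall M : 'M[C]_p,
    (forall i j, sqn (M i j - A i j) <= r) -> sqn (\det M - \det A) <= e.
Proof.
move: e; rewrite -/(cont A (fun M => \det M)) /determinant.
have cS (I : Type) (s : seq I) (F : I -> 'M[C]_p -> C) :
    (forall i, cont A (F i)) -> cont A (fun M => \sum_(i <- s) F i M).
  move=> cF; elim: s => [|i s IH].
    by under eq_fun do rewrite big_nil; exact: cont_cst.
  by under eq_fun do rewrite big_cons; exact: contD.
have cP (I : Type) (s : seq I) (F : I -> 'M[C]_p -> C) :
    (forall i, cont A (F i)) -> cont A (fun M => \prod_(i <- s) F i M).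
  move=> cF; elim: s => [|i s IH].
    by under eq_fun do rewrite big_nil; exact: cont_cst.
  by under eq_fun do rewrite big_cons; exact: contM.
apply: cS => s; apply: contM; first exact: cont_cst.
by apply: cP => i e e0; exists e.
Qed.

End det_continuity.

Section plus_measure.
Context {R : realType} {d : nat}.
Local Notation Z := 'rV[int]_d.
Implicit Types (P Q mu : probability (config d) R).

Definition collar (n k : nat) : set Z := box (n + k) `\` box n.

Lemma measurable_all_ones (A : set Z) : finite_set A ->
  measurable (all_ones A : set (config d)).
Proof. by move=> /finite_seqP[s ->]; exact: measurable_ones. Qed.

Lemma finite_collar n k : finite_set (collar n k).
Proof. by apply: sub_finite_set (finite_box (n + k)) => e []. Qed.

Lemma collar_le n k l : (k <= l)%N -> collar n k `<=` collar n l.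
Proof. by move=> kl e [h nh]; split=> //; apply: box_le h; rewrite leq_add2l. Qed.

Lemma cond_mean_ones P n k s :
  cond_mean P (all_ones (collar n k)) \1_(ones s) =
  fine (P (ones s `&` all_ones (collar n k))) / fine (P (all_ones (collar n k))).
Proof.
have mC := @measurable_all_ones _ (finite_collar n k).
by rewrite /cond_mean /Rintegral (integral_indic _ mC (measurable_ones s)).
Qed.

(** Test on the constant 1: a null conditioning event would make the conditional mean 0, since
    division by 0 gives 0, whereas the limit is 1. *)
Lemma plus_box_pos P n mu : plus_box P n mu ->
  \forall k \near \oo, P (all_ones (collar n k)) != 0%E.
Proof.
move=> /(_ \1_(ones [::])) h.
have {h} := h (fun eta eta' _ => _); rewrite ones_nil.
have -> : \int[mu]_eta \1_[set: config d] eta = 1.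
  rewrite indicT Rintegral_cst // mul1r.
  by have -> : fine (mu setT) = 1 by rewrite probability_setT.
move=> /(_ _)/wrap[|h]; first by rewrite indicT.
have /cvgrPdist_lt/(_ _ (@ltr01 R))[N _ HN] := h.
exists N => // k /HN /=; apply: contraTneq => P0.
by rewrite /cond_mean -/(collar n k) P0 /= invr0 mulr0 subr0 normr1 ltxx.
Qed.

Lemma plus_box_ones P n mu s : plus_box P n mu ->
  (forall e, e \in s -> box n e) ->
  fine (P (ones s `&` all_ones (collar n k))) / fine (P (all_ones (collar n k)))
    @[k --> \oo] --> fine (mu (ones s)).
Proof.
move=> /(_ \1_(ones s)) h sn.
have {h} := h _; rewrite /Rintegral integral_indic //; last exact: measurable_ones.
rewrite setIT => h; under eq_fun do rewrite -cond_mean_ones.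
apply: h => eta eta' E; rewrite !indicE; congr (_%:R); congr nat_of_bool.
apply/idP/idP => /set_mem h; apply/mem_set => e es.
  by rewrite -E ?h //; exact: sn.
by rewrite E ?h //; exact: sn.
Qed.

Lemma weak_star_ones (mu : nat -> probability (config d) R) Q s :
  weak_star_cvg mu Q -> fine (mu n (ones s)) @[n --> \oo] --> fine (Q (ones s)).
Proof.
move=> /(_ \1_(ones s) (@continuous_indic_ones d R s)).
have ms := @measurable_ones d s.
rewrite /Rintegral (integral_indic _ measurableT ms) setIT.
by under eq_fun do rewrite (integral_indic _ measurableT ms) setIT.
Qed.

Lemma finite_enum (A : set Z) : finite_set A ->
  exists m (b : 'I_m -> Z), injective b /\ range b = A.
Proof.
move=> /finite_seqP[s0 E]; pose s := undup s0.
exists (size s), (fun i => tnth (in_tuple s) i); split.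
  by apply/tuple_uniqP; exact: undup_uniq.
rewrite E; apply/seteqP; split=> e /=.
  by move=> [i _ <-]; rewrite -mem_undup; exact: mem_tnth.
rewrite -mem_undup => es; have /tnthP[i ->] : e \in in_tuple s by [].
by exists i.
Qed.

Lemma ones_range p (a : 'I_p -> Z) : all_ones (range a) = ones (codom a).
Proof.
apply/seteqP; split=> eta h e'; first by move=> /codomP[i ->]; apply: h; exists i.
by move=> [i _ <-]; apply: h; rewrite /= codom_f.
Qed.

End plus_measure.

(** * The space L^2(1/f) *)

Section quotient_norm.
Context {R : realType} {d : nat} (f : d.-tuple R -> R).
Context (f_meas : measurable_fun setT f) (f01 : forall x, 0 <= f x <= 1).
Local Notation X := (d.-tuple R).
Local Notation lam := (@torus_measure R d).
Implicit Types (h T : X -> R[i]) (x : X).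

Let f0 x : 0 <= f x. Proof. by case/andP: (f01 x). Qed.

Lemma sqnorm_div_pos h x : f x != 0 -> sqnorm_div f h x = (sqn (h x) / f x)%:E.
Proof. by move=> fx; rewrite /sqnorm_div sqr_normc inver (negbTE fx). Qed.

Lemma sqnorm_div_00 h x : h x = 0 -> sqnorm_div f h x = 0%E.
Proof. by move=> hx; rewrite /sqnorm_div sqr_normc hx sqn0 mul0e. Qed.

Lemma sqnorm_div_n0 h x : f x = 0 -> h x != 0 -> sqnorm_div f h x = +oo%E.
Proof.
move=> fx hx; rewrite /sqnorm_div sqr_normc inver fx eqxx gt0_muley //.
by rewrite lte_fin lt_neqAle sqn_ge0 eq_sym sqn_eq0 hx.
Qed.

Lemma sqnorm_div_ge0 h x : (0 <= sqnorm_div f h x)%E.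
Proof.
have [hx|hx] := eqVneq (h x) 0; first by rewrite sqnorm_div_00.
have [fx|fx] := eqVneq (f x) 0; first by rewrite sqnorm_div_n0.
by rewrite sqnorm_div_pos // lee_fin divr_ge0 // sqn_ge0.
Qed.

(** The denominator is bounded away from 0, so the quotient is a real number, bounded when [h] is.
    It increases with [m] to [sqnorm_div f h], also where that is infinite. *)
Definition reg_quot h (m : nat) x : R := sqn (h x) / (f x + m.+1%:R^-1).

Let den_gt0 m x : 0 < f x + m.+1%:R^-1.
Proof. by rewrite ltr_wpDl // invr_gt0. Qed.

Lemma reg_quot_ge0 h m x : 0 <= reg_quot h m x.
Proof. by rewrite divr_ge0 ?sqn_ge0 // ltW. Qed.

Lemma measurable_reg_quot h m : measurable_fun setT (fun x => complex.Re (h x)) ->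
  measurable_fun setT (fun x => complex.Im (h x)) ->
  measurable_fun setT (reg_quot h m).
Proof.
move=> mr mi; apply: measurable_funM; first exact: measurable_sqn_comp.
apply: measurable_invr_ge0; first exact: measurable_funD.
by move=> x; exact: ltW.
Qed.

Lemma cvg_reg_quot h x : (reg_quot h m x)%:E @[m --> \oo] --> sqnorm_div f h x.
Proof.
have [hx|hx] := eqVneq (h x) 0.
  rewrite sqnorm_div_00 //; apply: cvg_near_cst; apply: nearW => m.
  by rewrite /reg_quot hx sqn0 mul0r.
have [fx|fx] := eqVneq (f x) 0.
  rewrite sqnorm_div_n0 //; apply/cvgeryP.
  rewrite /reg_quot fx; under eq_fun do rewrite add0r invrK.
  have s0 : 0 < sqn (h x) by rewrite lt_neqAle sqn_ge0 eq_sym sqn_eq0 hx.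
  apply/cvgryPge => A.
  have /cvgryPge/(_ (A / sqn (h x))) := @cvgr_idn R; apply: filterS => m.
  rewrite ler_pdivrMr // mulrC => /le_trans; apply.
  by rewrite ler_wpM2l ?ler_nat // ltW.
rewrite sqnorm_div_pos //; apply: cvg_EFin; first exact: nearW.
rewrite /comp /reg_quot /=; apply: cvgM; first exact: cvg_cst.
apply: cvgV => //; rewrite -[X in _ --> X]addr0; apply: cvgD; first exact: cvg_cst.
exact: cvg_harmonic.
Qed.

Lemma reg_quot_nd h x :
  {homo (fun m => (reg_quot h m x)%:E) : m n / (m <= n)%N >-> (m <= n)%E}.
Proof.
move=> m n mn; rewrite lee_fin /reg_quot ler_wpM2l ?sqn_ge0 //.
by rewrite lef_pV2 ?posrE // lerD2l lef_pV2 ?posrE // ler_nat.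
Qed.

Lemma measurable_sqnorm_div h : measurable_fun setT (fun x => complex.Re (h x)) ->
  measurable_fun setT (fun x => complex.Im (h x)) ->
  measurable_fun setT (sqnorm_div f h).
Proof.
move=> mr mi; apply: (emeasurable_fun_cvg (fun m x => (reg_quot h m x)%:E)).
  by move=> m; apply/measurable_EFinP; exact: measurable_reg_quot.
by move=> x _; exact: cvg_reg_quot.
Qed.

Lemma integral_sqnorm_div_le h (M : R) :
  measurable_fun setT (fun x => complex.Re (h x)) ->
  measurable_fun setT (fun x => complex.Im (h x)) ->
  (forall m, (\int[lam]_x (reg_quot h m x)%:E <= M%:E)%E) ->
  (\int[lam]_x sqnorm_div f h x <= M%:E)%E.
Proof.
move=> mr mi hM.
have c : (\int[lam]_x (reg_quot h m x)%:E)%E @[m --> \oo] -->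
    (\int[lam]_x sqnorm_div f h x)%E.
  rewrite (_ : (\int[lam]_x sqnorm_div f h x)%E =
     (\int[lam]_x limn (fun m => (reg_quot h m x)%:E))%E); last first.
    by apply: eq_integral => x _; apply/esym/cvg_lim => //; exact: cvg_reg_quot.
  apply: cvg_monotone_convergence => //.
  - by move=> m; apply/measurable_EFinP; exact: measurable_reg_quot.
  - by move=> m x _; rewrite lee_fin reg_quot_ge0.
  - by move=> x _; exact: reg_quot_nd.
rewrite -(cvg_lim _ c) //; apply: lime_le; first exact: cvgP c.
exact: nearW.
Qed.

Lemma integrable_sqnorm_div h : measurable_fun setT (fun x => complex.Re (h x)) ->
  measurable_fun setT (fun x => complex.Im (h x)) ->
  (\int[lam]_x sqnorm_div f h x < +oo)%E <-> lam.-integrable setT (sqnorm_div f h).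
Proof.
move=> mr mi; have E : (\int[lam]_x `|sqnorm_div f h x| =
    \int[lam]_x sqnorm_div f h x)%E.
  by apply: eq_integral => x _; rewrite gee0_abs // sqnorm_div_ge0.
split=> [h1|/integrableP[_]]; last by rewrite E.
by apply/integrableP; split; [exact: measurable_sqnorm_div|rewrite E].
Qed.

Lemma L2inv_norm_lt h (e : R) : 0 < e ->
  (L2inv_norm f h < e%:E)%E <-> (\int[lam]_x sqnorm_div f h x < (e ^+ 2)%:E)%E.
Proof.
move=> e0; rewrite /L2inv_norm.
have : (0 <= \int[lam]_x sqnorm_div f h x)%E.
  by apply: integral_ge0 => x _; exact: sqnorm_div_ge0.
case: (\int[lam]_x _)%E => [r|_|//]; last by rewrite poweRyr // !ltNge !leey.
rewrite lee_fin => r0; rewrite poweR_EFin !lte_fin powR12_sqrt //.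
rewrite -[X in _ <-> is_true (X < _)](sqr_sqrtr r0).
by rewrite ltr_pXn2r // nnegrE ?sqrtr_ge0 // ltW.
Qed.

Lemma nrm2_one h : bmeas h ->
  (\int[lam]_x (sqn (h x) * 1)%:E)%E = (nrm2 (fun=> 1) h)%:E.
Proof.
move=> bh; rewrite /nrm2 /Rintegral.
have -> : (\int[lam]_x (1 * sqn (h x))%:E)%E = (\int[lam]_x (sqn (h x) * 1)%:E)%E.
  by apply: eq_integral => x _; rewrite mulrC.
rewrite fineK //.
have bq : bmeas (fun x => h x * (h x)^*%C) by apply: bmeasM => //; exact: bmeas_conj.
have /bmeas_integrable[i1 _] := bq.
apply: (integrable_fin_num measurableT).
apply: eq_integrable i1 => // x _.
by rewrite mulc_conj mulr1.
Qed.

End quotient_norm.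

Section form_extras.
Context {R : realType} {d : nat} (f : d.-tuple R -> R).
Context (f_meas : measurable_fun setT f) (f01 : forall x, 0 <= f x <= 1).
Local Notation X := (d.-tuple R).
Local Notation lam := (@torus_measure R d).
Implicit Types u v w h T : X -> R[i].

Lemma ipBr u v w : bmeas u -> bmeas v -> bmeas w ->
  ip f u (fun x => v x - w x) = ip f u v - ip f u w.
Proof.
move=> bu bv bw; have bvw := bmeasB bv bw.
rewrite (ip_conj f_meas f01 bvw bu) ipB //.
rewrite (ip_conj f_meas f01 bv bu) (ip_conj f_meas f01 bw bu).
exact: rmorphB.
Qed.

Lemma ip_sumr (I : Type) (s : seq I) (c : I -> R[i]) (F : I -> X -> R[i]) u :
  (forall i, bmeas (F i)) -> bmeas u ->
  ip f u (fun x => \sum_(i <- s) c i * F i x) =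
  \sum_(i <- s) (c i)^*%C * ip f u (F i).
Proof.
move=> bF bu.
have bs : bmeas (fun x => \sum_(i <- s) c i * F i x).
  by apply: bmeas_sum => i; apply: bmeasM => //; exact: bmeas_cst.
rewrite (ip_conj f_meas f01 bs bu) ip_sum // rmorph_sum.
apply: eq_bigr => i _; rewrite (ip_conj f_meas f01 (bF i) bu).
exact: conjcM.
Qed.

Lemma nrm2_le_one u : bmeas u -> nrm2 f u <= nrm2 (fun=> 1) u.
Proof.
move=> bu.
have int (g : X -> R) : measurable_fun setT g -> (forall x, 0 <= g x <= 1) ->
    lam.-integrable setT (EFin \o (fun x => g x * sqn (u x))).
  move=> mg g01.
  have bg : bmeas (fun x => (g x)%:C * (u x * (u x)^*%C)).
    apply: bmeasM; last by apply: bmeasM => //; exact: bmeas_conj.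
    apply: (@bmeas_real _ _ _ 1) => // x; have /andP[? ?] := g01 x.
    by rewrite ger0_norm.
  have /bmeas_integrable[+ _] := bg; apply: eq_integrable => // x _.
  by rewrite /= mulc_conj /= mul0r subr0.
apply: le_Rintegral => //; first exact: int.
- by apply: int => // x; rewrite ler01 lexx.
- by move=> x _; rewrite ler_wpM2r ?sqn_ge0 //; have /andP[] := f01 x.
Qed.

Lemma nrm2_sub_le u v : bmeas u -> bmeas v ->
  nrm2 f (fun x => u x - v x) <= 2 * nrm2 f u + 2 * nrm2 f v.
Proof.
move=> bu bv; rewrite nrm2_sub //.
have := ip_cauchy_schwarz f_meas f01 bu bv.
have := nrm2_ge0 f01 u; have := nrm2_ge0 f01 v.
rewrite /sqn mulr2n; move: (nrm2 f u) (nrm2 f v) (ip f u v) => a b [x y] /= *.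
have : x ^+ 2 <= a * b by have := sqr_ge0 y; lra.
have := sqr_ge0 (a - b); have := sqr_ge0 (a + b + 2 * x); nra.
Qed.

End form_extras.

(** * Duality between L^2(f) and L^2(1/f) *)

Section duality.
Context {R : realType} {d : nat} (f : d.-tuple R -> R).
Context (f_meas : measurable_fun setT f) (f01 : forall x, 0 <= f x <= 1).
Local Notation X := (d.-tuple R).
Local Notation lam := (@torus_measure R d).
Local Notation ip1 := (ip (fun _ : X => 1 : R)).

Let m1 : measurable_fun setT (fun _ : X => 1 : R).
Proof. exact: measurable_cst. Qed.

Let h01 (x : X) : 0 <= (1 : R) <= 1.
Proof. by rewrite ler01 lexx. Qed.

Lemma ip1_cexp (k l : 'rV[int]_d) : ip1 (cexp k) (cexp l) = (k == l)%:R.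
Proof.
rewrite -subr_eq0 -(@cint_cexp R) /ip; congr torus_cintegral.
by apply/funext => x; rewrite mul1r cexpD cexpN.
Qed.

(* Tested against T / (f + 1/(m+1)), the bound says that I^2 <= 4 M I for
   I the integral of |T|^2 / (f + 1/(m+1)). *)
Lemma bounded_functional_quotient (T : X -> R[i]) (M : R) : bmeas T -> 0 <= M ->
  (forall h, trig_poly h -> sqn (ip1 T h) <= M * nrm2 f h) ->
  (\int[lam]_x sqnorm_div f T x <= (4 * M)%:E)%E.
Proof.
move=> bT M0 HT; have [rT iT [B HB]] := bT.
apply: integral_sqnorm_div_le => // m.
have c0 : 0 < m.+1%:R^-1 :> R by rewrite invr_gt0.
have den0 x : 0 < f x + m.+1%:R^-1 by rewrite ltr_wpDl //; case/andP: (f01 x).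
pose v (x : X) := (f x + m.+1%:R^-1)^-1.
have mv : measurable_fun setT v.
  apply: measurable_invr_ge0; first exact: measurable_funD.
  by move=> x; exact: ltW.
have bv : bmeas (fun x => (v x)%:C).
  apply: (@bmeas_real _ _ _ m.+1%:R) => // x.
  rewrite /v ger0_norm; last by rewrite invr_ge0 ltW.
  rewrite -[leRHS]invrK lef_pV2 ?posrE //.
  by rewrite lerDr; case/andP: (f01 x).
pose g x := (v x)%:C * T x.
have bg : bmeas g by exact: bmeasM.
pose I := \int[lam]_x reg_quot f T m x.
have ipTg : ip1 T g = I%:C.
  rewrite /I /ip; apply: eq_complexP => /=.
    apply: eq_Rintegral => x _; rewrite /g conjcM conjc_real mul1r mulrCA mulc_conj.
    by rewrite -rmorphM /= mulrC.
  under eq_Rintegral => x _ do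
    rewrite /g conjcM conjc_real mul1r mulrCA mulc_conj -rmorphM /=.
  by rewrite Rintegral_cst // mul0r.
have brq : bmeas (fun x => (reg_quot f T m x)%:C).
  rewrite (_ : (fun x => _) = fun x => (v x)%:C * (T x * (T x)^*%C)).
    by apply: bmeasM => //; apply: bmeasM => //; exact: bmeas_conj.
  by apply/funext => x; rewrite mulc_conj -rmorphM /= mulrC.
have [irq _] := bmeas_integrable brq.
have I0 : 0 <= I.
  by apply: Rintegral_ge0 => x _; exact: reg_quot_ge0.
(* Pointwise, f v^2 <= v because f v <= 1. *)
have gI : nrm2 f g <= I.
  have bfg : bmeas (fun x => (f x)%:C * (g x * (g x)^*%C)).
    apply: bmeasM; last by apply: bmeasM => //; exact: bmeas_conj.
    apply: (@bmeas_real _ _ _ 1) => // x; have /andP[? ?] := f01 x.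
    by rewrite ger0_norm.
  have [ifg _] := bmeas_integrable bfg.
  apply: le_Rintegral => //.
    by apply: eq_integrable ifg => // x _; rewrite mulc_conj /= mul0r subr0.
  move=> x _; rewrite /g sqnM sqn_real /reg_quot -/(v x) mulrC mulrAC mulrC.
  rewrite ler_wpM2l ?sqn_ge0 // expr2 -mulrA ler_piMr //.
    by rewrite invr_ge0 ltW.
  by rewrite mulrC ler_pdivrMr // mul1r lerDl ltW.
suff H : I <= 4 * M.
  rewrite -[X in (X <= _)%E]fineK ?lee_fin //.
  exact: integrable_fin_num irq.
have gfin : (\int[lam]_x (sqn (g x) * 1)%:E < +oo)%E.
  by rewrite nrm2_one // ltry.
have wfin : (\int[lam]_x (1 : R)%:E < +oo)%E by rewrite integral_prob_cst ltry.
have [rg ig _] := bg.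
suff H : I ^+ 2 <= 4 * M * I.
  have [->|In0] := eqVneq I 0; first by rewrite mulr_ge0.
  by rewrite -(@ler_pM2r _ I) ?lt_neqAle ?I0 1?eq_sym ?In0 // -expr2.
pose N := nrm2 (fun=> 1) T.
have N0 : 0 <= N by exact: nrm2_ge0.
rewrite leNgt; apply/negP => Hlt.
(* The test function [g] is not a trigonometric polynomial, so it is replaced by [h] at squared
   unweighted distance below [D]. This gives I^2 <= 4 M I + (4 M + 2 N) D, which contradicts the
   choice of [D]. The 4 comes from splitting squared sums twice. *)
pose D := (I ^+ 2 - 4 * M * I) / (4 * M + 2 * N + 1).
have K0 : 0 < 4 * M + 2 * N + 1 by lra.
have D0 : 0 < D by rewrite divr_gt0 // subr_gt0.
have [h th] := trig_poly_dense m1 (fun=> @ler01 R) wfin rg ig gfin D0.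
have bh := bmeas_trig th; have bgh := bmeasB bg bh.
rewrite nrm2_one // lte_fin => hD.
have E1 : ip1 T g = ip1 T h + ip1 T (fun x => g x - h x).
  by rewrite ipBr // addrC subrK.
have := sqnD_le (ip1 T h) (ip1 T (fun x => g x - h x)).
rewrite -E1 ipTg sqn_real => H1.
have H2 := HT _ th.
have H3 := ip_cauchy_schwarz m1 h01 bT bgh.
have H4 : nrm2 f h <= 2 * nrm2 f g + 2 * nrm2 (fun=> 1) (fun x => g x - h x).
  apply: (@le_trans _ _ (2 * nrm2 f g + 2 * nrm2 f (fun x => g x - h x))); last first.
    by rewrite lerD2l ler_wpM2l // nrm2_le_one.
  have -> : nrm2 f h = nrm2 f (fun x => g x - (g x - h x)).
    by congr nrm2; apply/funext => x; rewrite opprB addrC subrK.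
  exact: nrm2_sub_le.
have DK : D * (4 * M + 2 * N + 1) = I ^+ 2 - 4 * M * I.
  by rewrite /D divfK // gt_eqF.
move: H1 H2 H3 H4 hD D0 DK gI; rewrite -/N.
have := nrm2_ge0 h01 (fun x => g x - h x).
move: (nrm2 _ (fun x => g x - h x)) (sqn (ip1 T h)) (sqn (ip1 T _)) => y a b.
move: (nrm2 f h) (nrm2 f g) => z t y0 H1 H2 H3 H4 hD D0 DK gI.
have : M * z <= M * (2 * t + 2 * y) by rewrite ler_wpM2l.
have : M * t <= M * I by rewrite ler_wpM2l.
have : M * y <= M * D by rewrite ler_wpM2l // ltW.
have : N * y <= N * D by rewrite ler_wpM2l // ltW.
lra.
Qed.

End duality.

Lemma ip0l {R : realType} {d : nat} (f : d.-tuple R -> R) v :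
  ip f (fun=> 0) v = 0.
Proof.
rewrite /ip (_ : (fun x => _) = fun=> 0) ?cint_cst //.
by apply/funext => x; rewrite mul0r mulr0.
Qed.

(** * From a nontrivial limit law to a polynomial in L^2(1/f) *)

Section plus_limits.
Context {R : realType} {d : nat} (f : d.-tuple R -> R).
Context (f_meas : measurable_fun setT f) (f01 : forall x, 0 <= f x <= 1).
Context (P : probability (config d) R) (hP : determinantal f P).
Local Notation X := (d.-tuple R).
Local Notation lam := (@torus_measure R d).
Local Notation Z := 'rV[int]_d.
Local Notation ip1 := (ip (fun _ : X => 1 : R)).
Implicit Types (u v h T : X -> R[i]) (A B : set Z).

Definition exp_span A : set (X -> R[i]) := [set u |
  exists m (b : 'I_m -> Z) (c : 'I_m -> R[i]), (forall l, A (b l)) /\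
    u = fun x => \sum_(l < m) c l * cexp (b l) x].

Lemma bmeas_exp_span A u : exp_span A u -> bmeas u.
Proof.
move=> [m [b [c [_ ->]]]]; apply: bmeas_sum => l.
by apply: bmeasM; [exact: bmeas_cst|exact: bmeas_cexp].
Qed.

Lemma exp_span_sub A B u : A `<=` B -> exp_span A u -> exp_span B u.
Proof.
by move=> AB [m [b [c [Ab ->]]]]; exists m, b, c; split=> // l; exact: AB.
Qed.

Lemma ip_exp_span0 A u v : bmeas v -> (forall e, A e -> ip f v (cexp e) = 0) ->
  exp_span A u -> ip f v u = 0.
Proof.
move=> bv h [m [b [c [Ab ->]]]]; rewrite ip_sumr // => [|l]; last exact: bmeas_cexp.
by rewrite big1 // => l _; rewrite h ?mulr0.
Qed.

Definition collar_prob n k s : R :=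
  fine (P (ones s `&` all_ones (collar n k))) / fine (P (all_ones (collar n k))).

Lemma collar_det n k p (a : 'I_p -> Z) : injective a -> (forall i, box n (a i)) ->
  P (all_ones (collar n k)) != 0%E ->
  exists u : 'I_p -> X -> R[i],
  [/\ forall i, exp_span (collar n k) (u i),
      forall i e, collar n k e -> ip f (fun x => cexp (a i) x - u i x) (cexp e) = 0 &
      (collar_prob n k (codom a))%:C = \det (\matrix_(i < p, j < p)
        ip f (fun x => cexp (a i) x - u i x) (cexp (a j)))].
Proof.
move=> ia an; have [m [b [ib Eb]]] := finite_enum (@finite_collar d n k).
have cb l : collar n k (b l) by rewrite -Eb; exists l.
rewrite /collar_prob -ones_range -Eb => Pb.
have ba i j : b i <> a j by move=> E; have [_] := cb i; apply; rewrite E; exact: an.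
have [u [su ou du]] := cond_det f_meas f01 hP ib ia ba Pb.
exists u; split=> //.
  by move=> i; have [c ->] := su i; exists m, b, c; split.
by move=> i e -[l _ <-]; exact: ou.
Qed.

Lemma probability_ones_det p (a : 'I_p -> Z) : injective a ->
  (fine (P (ones (codom a))))%:C =
  \det (\matrix_(i < p, j < p) ip f (cexp (a i)) (cexp (a j))).
Proof. by move=> ia; rewrite -ones_range (det_all_ones hP). Qed.

(* The projections q_k of e away from the exponentials in the collars form a
   Cauchy sequence in L^2(f), because |q_k - q_l|^2 is a difference of terms of
   the convergent sequence of conditional probabilities. T is the limit of
   f q_k, obtained from its Fourier coefficients. *)
Lemma nonzero_plus_quotient n mu e : plus_box P n mu -> box n e ->
  fine (mu (ones [:: e])) != 0 ->
  exists T, [/\ trig_poly T, T <> (fun=> 0) & lam.-integrable setT (sqnorm_div f T)].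
Proof.
move=> hmu ne; set c := fine _ => c0.
have [K _ HK] := plus_box_pos hmu.
pose s k := collar_prob n k [:: e].
have sc : s k @[k --> \oo] --> c.
  by apply: plus_box_ones => // e'; rewrite inE => /eqP ->.
have /choice[u Hu] k : exists u, (K <= k)%N -> [/\ exp_span (collar n k) u,
    (forall e', collar n k e' -> ip f (fun x => cexp e x - u x) (cexp e') = 0) &
    (s k)%:C = ip f (fun x => cexp e x - u x) (cexp e)].
  have [Kk|Kk] := leqP K k; last by exists (fun=> 0).
  have [||u [su ou du]] := @collar_det n k 1 (fun=> e) _ _ (HK _ Kk) => //.
    by move=> i j _; rewrite !ord1.
  exists (u ord0) => _; split=> //; first by move=> e'; exact: ou.
  rewrite /s (_ : [:: e] = codom (fun _ : 'I_1 => e)) ?du ?det_mx11 ?mxE //.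
  by rewrite /codom /image_mem enum_ordSl /= [enum _]size0nil // size_enum_ord.
pose q k x := cexp e x - u k x.
have bu k : (K <= k)%N -> bmeas (u k).
  by move=> /Hu[su _ _]; exact: bmeas_exp_span su.
have be e' : bmeas (cexp e' : X -> R[i]) by exact: bmeas_cexp.
have bq k : (K <= k)%N -> bmeas (q k) by move=> Kk; apply: bmeasB => //; exact: bu.
have qs k v : (K <= k)%N -> exp_span (collar n k) v -> ip f (q k) v = 0.
  move=> Kk; have [_ ou _] := Hu k Kk; exact: ip_exp_span0 (bq k Kk) ou.
(* [u k] lies in the span for the smaller collar, hence is orthogonal to [q l]. So s k - s l is the
   squared distance from [q k] to [q l]. *)
have qkl k l : (K <= k)%N -> (k <= l)%N -> ip f (q l) (q k) = (s l)%:C.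
  move=> Kk kl; have Kl := leq_trans Kk kl; have [_ _ sl] := Hu l Kl.
  have [su _ _] := Hu k Kk.
  rewrite ipBr //; [|exact: bq|exact: bu].
  rewrite -/(q l) -sl [X in _ - X](qs l) ?subr0 //.
  by apply: exp_span_sub su; exact: collar_le.
have nq k : (K <= k)%N -> nrm2 f (q k) = s k.
  by move=> Kk; apply: complexI; rewrite -ip_nrm2 ?qkl //; exact: bq.
have dq k l : (K <= k)%N -> (k <= l)%N ->
    nrm2 f (fun x => q k x - q l x) = s k - s l.
  move=> Kk kl; have Kl := leq_trans Kk kl.
  rewrite nrm2_sub ?nq //; try exact: bq.
  rewrite (ip_conj f_meas f01 (bq _ Kl) (bq _ Kk)) qkl // Re_conjc /= mulr2n; ring.
(* The Fourier coefficient of f q_k at frequency [j]. *)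
pose tk k j := ip f (q k) (cexp j).
have dt k l j : (K <= k)%N -> (k <= l)%N -> sqn (tk k j - tk l j) <= s k - s l.
  move=> Kk kl; have Kl := leq_trans Kk kl.
  rewrite /tk -ipB //; try exact: bq.
  have bqq := bmeasB (bq _ Kk) (bq _ Kl).
  apply: (le_trans (ip_cauchy_schwarz f_meas f01 bqq (be j))).
  rewrite dq // ler_piMr ?nrm2_cexp_le1 // -dq //; exact: nrm2_ge0.
have cRe j : cvgn (fun k => complex.Re (tk k j)).
  apply: (cvg_of_sqr_le (K := K) sc) => k l Kk kl; apply: le_trans (dt k l j Kk kl).
  by rewrite /sqn ReD ReN lerDl sqr_ge0.
have cIm j : cvgn (fun k => complex.Im (tk k j)).
  apply: (cvg_of_sqr_le (K := K) sc) => k l Kk kl; apply: le_trans (dt k l j Kk kl).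
  by rewrite /sqn ImD ImN lerDr sqr_ge0.
pose t j : R[i] :=
  limn (fun k => complex.Re (tk k j)) +i* limn (fun k => complex.Im (tk k j)).
have [m [b [ib Eb]]] := finite_enum (@finite_box d n).
pose T (x : X) := \sum_(i < m) t (b i) * cexp (b i) x.
have tT : trig_poly T by exact: trig_poly_sum.
have bT := bmeas_trig tT.
have m1 : measurable_fun setT (fun _ : X => 1 : R) by exact: measurable_cst.
have h01 (x : X) : 0 <= (1 : R) <= 1 by rewrite ler01 lexx.
have Tin i : ip1 T (cexp (b i)) = t (b i).
  rewrite ip_sum // (bigD1 i) //= big1 => [|j ji].
    by rewrite ip1_cexp eqxx mulr1 addr0.
  by rewrite ip1_cexp (inj_eq ib) (negbTE ji) mulr0.
have Tout l : ~ box n l -> ip1 T (cexp l) = 0.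
  move=> nl; rewrite ip_sum // big1 // => i _; rewrite ip1_cexp.
  case: eqVneq => [bl|_]; last by rewrite mulr0.
  by exfalso; apply: nl; rewrite -bl -Eb; exists i.
pose ccvg (z : nat -> R[i]) (w : R[i]) :=
  complex.Re (z k) @[k --> \oo] --> (complex.Re w : R) /\
  complex.Im (z k) @[k --> \oo] --> (complex.Im w : R).
have cE l : ccvg (fun k => tk k l) (ip1 T (cexp l)).
  have [bl|nbl] := pselect (box n l).
    have [i _ <-] : range b l by rewrite Eb.
    by rewrite Tin; split; [exact: cRe|exact: cIm].
  have [N lN] := box_exists l.
  (* Once the collar reaches [l], orthogonality kills this coefficient; this is why the limit has
     only frequencies in [box n]. *)
  have tk0 k : (maxn K N <= k)%N -> tk k l = 0.
    move=> kN; have [_ ok _] := Hu k (leq_trans (leq_maxl _ _) kN).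
    apply: ok; split=> //; apply: box_le lN; apply: leq_trans (leq_addl n k).
    exact: leq_trans (leq_maxr _ _) kN.
  rewrite Tout //; split; apply: cvg_near_cst; exists (maxn K N) => // k kN;
    by rewrite tk0.
have cD z w z' w' : ccvg z w -> ccvg z' w' -> ccvg (fun k => z k + z' k) (w + w').
  move=> [zr zi] [zr' zi']; split.
    by rewrite ReD; under eq_fun do rewrite ReD; exact: cvgD.
  by rewrite ImD; under eq_fun do rewrite ImD; exact: cvgD.
have cM a z w : ccvg z w -> ccvg (fun k => a * z k) (a * w).
  move=> [zr zi]; split.
    rewrite ReM; under eq_fun do rewrite ReM.
    by apply: cvgB; apply: cvgM => //; exact: cvg_cst.
  rewrite ImM; under eq_fun do rewrite ImM.
  by apply: cvgD; apply: cvgM => //; exact: cvg_cst.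
have cS (I : Type) (r : seq I) (z : I -> nat -> R[i]) w :
    (forall i, ccvg (z i) (w i)) ->
    ccvg (fun k => \sum_(i <- r) z i k) (\sum_(i <- r) w i).
  move=> H; elim: r => [|i r IH].
    rewrite big_nil; under [X in ccvg X]eq_fun do rewrite big_nil.
    by split; exact: cvg_cst.
  by rewrite big_cons; under [X in ccvg X]eq_fun do rewrite big_cons; exact: cD.
(* The product of [T] with [h] is the limit of the weighted products of [q k] with [h], and
   Cauchy-Schwarz bounds their squared moduli by [s k * nrm2 f h]. *)
have HT h : trig_poly h -> sqn (ip1 T h) <= c * nrm2 f h.
  move=> [sh [a ->]].
  pose h' (x : X) : R[i] := \sum_(l <- sh) a l * cexp l x; rewrite -/h'.
  have bh : bmeas h' by apply: bmeas_trig; exists sh, a.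
  have [hr hi] : ccvg (fun k => \sum_(l <- sh) (a l)^*%C * tk k l) (ip1 T h').
    rewrite ip_sumr //; apply: cS => l; apply: cM; exact: cE.
  have cs : sqn (\sum_(l <- sh) (a l)^*%C * tk k l) @[k --> \oo] --> sqn (ip1 T h').
    rewrite /sqn; under eq_fun do rewrite !expr2.
    by rewrite !expr2; apply: cvgD; apply: cvgM.
  apply: (ler_cvg_to cs (g := fun k => s k * nrm2 f h')).
    by apply: cvgM => //; exact: cvg_cst.
  exists K => // k /= Kk; rewrite -nq //.
  have -> : \sum_(l <- sh) (a l)^*%C * tk k l = ip f (q k) h'.
    by rewrite ip_sumr //; exact: bq.
  by apply: ip_cauchy_schwarz => //; exact: bq.
have c_ge0 : 0 <= c by rewrite /c fine_ge0.
have := bounded_functional_quotient f_meas f01 bT c_ge0 HT.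
move=> bnd; have [mr mi _] := bT; exists T; split => //.
  move=> T0; have [i _ bi] : range b e by rewrite Eb.
  (* The coefficient at [e] itself is the limit of the [s k], which is [c] and not 0. *)
  have : t e = 0.
    by rewrite -bi -Tin T0 ip0l.
  have tke k : (K <= k)%N -> tk k e = (s k)%:C by move=> /Hu[_ _ ->].
  move=> /(congr1 (@complex.Re R)) /=.
  have -> : limn (fun k => complex.Re (tk k e)) = c.
    apply/cvg_lim => //; apply: cvg_trans sc; apply: near_eq_cvg.
    by exists K => // k Kk; rewrite tke.
  by move/eqP; rewrite (negbTE c0).
apply/(integrable_sqnorm_div f_meas f01 mr mi).
by apply: le_lt_trans bnd _; rewrite ltry.
Qed.

End plus_limits.

(** * The equivalences and the dichotomy *)

Section equivalences.
Context {R : realType} {d : nat} (f : d.-tuple R -> R).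
Context (f_per : periodicZ f).
Context (f_meas : measurable_fun setT f) (f01 : forall x, 0 <= f x <= 1).
Local Notation X := (d.-tuple R).
Local Notation lam := (@torus_measure R d).
Local Notation Z := 'rV[int]_d.
Local Notation ip1 := (ip (fun _ : X => 1 : R)).
Local Notation F := (fun x : X => (f x)%:C).
Local Notation closure := (L2inv_closure f (trig_poly (d := d) `&` L2inv f)).

Let bF : bmeas F.
Proof.
apply: (@bmeas_real _ _ _ 1) => // x; have /andP[f0 f1] := f01 x.
by rewrite ger0_norm.
Qed.

Lemma sqnorm_div_self x : sqnorm_div f F x = (f x)%:E.
Proof.
have [fx|fx] := eqVneq (f x) 0; first by rewrite sqnorm_div_00 fx.
by rewrite sqnorm_div_pos // sqn_real expr2 mulfK.
Qed.

Lemma integral_f_fin : (\int[lam]_x (f x)%:E < +oo)%E.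
Proof.
apply: (@le_lt_trans _ _ (\int[lam]_x 1%:E)%E); last by rewrite integral_prob_cst ltry.
apply: ge0_le_integral => //.
- by move=> x _; rewrite lee_fin; case/andP: (f01 x).
- exact/measurable_EFinP.
- by move=> x _; rewrite lee_fin; case/andP: (f01 x).
Qed.

Lemma L2inv_self : L2inv f F.
Proof.
have [mr mi _] := bF; split => //.
  by move=> x k; rewrite f_per.
by under eq_integral do rewrite sqnorm_div_self; exact: integral_f_fin.
Qed.

Lemma closure_exists_lt (r : R) : closure F -> 0 < r ->
  exists T, [/\ trig_poly T, L2inv f T &
    (\int[lam]_x sqnorm_div f (fun y => (F y - T y)%R) x < r%:E)%E].
Proof.
(* The closure controls a norm and the conclusion its square; e <= 1 gives e^2 <= e <= r. *)
move=> [_ H] r0; pose e := Num.min 1 r.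
have e0 : 0 < e by rewrite lt_min ltr01.
have [T [tT LT]] := H e e0; rewrite L2inv_norm_lt // => HT.
exists T; split=> //; apply: lt_le_trans HT _; rewrite lee_fin.
have e1 : e <= 1 by rewrite ge_min lexx.
have er : e <= r by rewrite ge_min lexx orbT.
by rewrite expr2; nra.
Qed.

(** The squared norm of [f] in L^2(1/f) is its integral, which is positive; a polynomial at smaller
    squared distance from [f] cannot be 0. *)
Lemma closure_quotient : ~ {ae lam, forall x, f x = 0} -> closure F ->
  exists T : X -> R[i], [/\ trig_poly T, T <> (fun=> 0) &
    lam.-integrable setT (sqnorm_div f T)].
Proof.
move=> fn0 cF.
have [r Er] : exists r : R, (\int[lam]_x (f x)%:E = r%:E)%E.
  exists (fine (\int[lam]_x (f x)%:E)); rewrite fineK // ge0_fin_numE ?integral_f_fin //.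
  by apply: integral_ge0 => x _; rewrite lee_fin; case/andP: (f01 x).
have r0 : 0 < r.
  rewrite -lte_fin -Er lt_neqAle integral_ge0 ?andbT => [|x _]; last first.
    by rewrite lee_fin; case/andP: (f01 x).
  apply/eqP => E; apply: fn0.
  have : (\int[lam]_x `|(f x)%:E| = 0)%E.
    apply: etrans (esym E).
    apply: eq_integral => x _; rewrite gee0_abs // lee_fin.
    by case/andP: (f01 x).
  move/(ae_eq_integral_abs _ measurableT); move=> /(_ _)/wrap[|h].
    exact/measurable_EFinP.
  by apply: filterS h => x /(_ I)[].
have [T [tT [_ mr mi fT] HT]] := closure_exists_lt cF r0.
exists T; split=> //; last exact/(integrable_sqnorm_div f_meas f01 mr mi).
move=> T0; move: HT; rewrite -Er.
under eq_integral => x _.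
  rewrite (_ : sqnorm_div _ _ x = (f x)%:E); last first.
    by rewrite -sqnorm_div_self T0; congr (sqnorm_div f _ x);
      apply/funext => y; rewrite subr0.
  over.
by rewrite ltxx.
Qed.

(* If p is close to f / T in L^2(|T|^2 / f), then T p is close to f in
   L^2(1/f). *)
Lemma quotient_closure (T : X -> R[i]) : trig_poly T -> T <> (fun=> 0) ->
  lam.-integrable setT (sqnorm_div f T) -> closure F.
Proof.
move=> tT T0 iT; split; first exact: L2inv_self.
move=> e e0; have bT := bmeas_trig tT; have [mr mi [B HB]] := bT.
have Tae : {ae lam, forall x, T x <> 0}.
  exists [set x | T x = 0]; split; first exact: measurable_zeros.
    exact: trig_poly_ae_neq0.
  by move=> x /= /contrapT.
(* Where [T] is nonzero, finiteness of |T|^2 / f forces [f] to be nonzero. *)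
have fae : {ae lam, forall x, T x <> 0 /\ f x <> 0}.
  have h := integrable_ae measurableT iT.
  apply: filterS2 Tae h => x Tx /(_ I) fin; split=> // fx.
  by move: fin; rewrite sqnorm_div_n0 //; exact/eqP.
(* Real division makes [w] vanish where [f] does, whereas [sqnorm_div f T] may be infinite there;
   elsewhere they agree. *)
pose w x := sqn (T x) / f x.
have f_ge0 x : 0 <= f x by case/andP: (f01 x).
have w0 x : 0 <= w x by rewrite divr_ge0 // sqn_ge0.
have mV : measurable_fun setT (fun x => (f x)^-1).
  exact: measurable_invr_ge0.
have mw : measurable_fun setT w.
  by apply: measurable_funM => //; exact: measurable_sqn_comp.
have wle x : ((w x)%:E <= sqnorm_div f T x)%E.
  have [fx|fx] := eqVneq (f x) 0; last by rewrite sqnorm_div_pos.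
  by rewrite /w fx invr0 mulr0; exact: sqnorm_div_ge0.
have fT : (\int[lam]_x sqnorm_div f T x < +oo)%E.
  exact/(integrable_sqnorm_div f_meas f01 mr mi).
have wfin : (\int[lam]_x (w x)%:E < +oo)%E.
  apply: le_lt_trans fT; apply: ge0_le_integral => //.
  - by move=> x _; rewrite lee_fin.
  - exact/measurable_EFinP.
  - exact: measurable_sqnorm_div.
pose h x : R[i] := F x / T x.
have sV x : (T x)^-1 = ((sqn (T x))^-1)%:C * (T x)^*%C.
  have [->|Tx] := eqVneq (T x) 0; first by rewrite invr0 conjc0 mulr0.
  apply: (mulfI Tx); rewrite divff // mulrCA mulc_conj -rmorphM /=.
  by rewrite mulVf ?sqn_eq0.
have msV : measurable_fun setT (fun x => (sqn (T x))^-1).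
  apply: measurable_invr_ge0; first exact: measurable_sqn_comp.
  by move=> x; exact: sqn_ge0.
have mhr : measurable_fun setT (fun x => complex.Re (h x)).
  rewrite (_ : (fun x => _) = fun x => f x * ((sqn (T x))^-1 * complex.Re (T x))).
    by apply: measurable_funM => //; exact: measurable_funM.
  apply/funext => x; rewrite /h sV !ReM !ImM Re_conjc Im_conjc /=.
  by ring.
have mhi : measurable_fun setT (fun x => complex.Im (h x)).
  rewrite (_ : (fun x => _) = fun x => f x * ((sqn (T x))^-1 * - complex.Im (T x))).
    apply: measurable_funM => //; apply: measurable_funM => //.
    exact: measurableT_comp.
  apply/funext => x; rewrite /h sV !ImM !ReM Re_conjc Im_conjc /=.
  by ring.
have hw x : sqn (h x) * w x <= f x.
  rewrite /h /w sqnM sqnV sqn_real.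
  have [fx|fx] := eqVneq (f x) 0; first by rewrite fx invr0 !mulr0.
  have [Tx|Tx] := eqVneq (sqn (T x)) 0; first by rewrite Tx mul0r mulr0.
  rewrite le_eqVlt; apply/orP; left; apply/eqP; field.
  by rewrite fx Tx.
have hfin : (\int[lam]_x (sqn (h x) * w x)%:E < +oo)%E.
  apply: le_lt_trans integral_f_fin; apply: ge0_le_integral => //.
  - by move=> x _; rewrite lee_fin mulr_ge0 // sqn_ge0.
  - by apply/measurable_EFinP; apply: measurable_funM => //; exact: measurable_sqn_comp.
  - exact/measurable_EFinP.
  - by move=> x _; rewrite lee_fin.
have e2 : 0 < e ^+ 2 by rewrite exprn_gt0.
have [p tp hp] := trig_poly_dense mw w0 wfin mhr mhi hfin e2.
have bp := bmeas_trig tp; have tg := trig_polyM tT tp.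
have bg := bmeas_trig tg; have [mgr mgi _] := bg.
exists (fun x => T x * p x).
  split=> //; split=> //; first exact: periodicZ_trig_poly.
  have [_ _ [N HN]] := bp.
  (* [N] bounds both parts of [p], so 2 N^2 bounds |p|^2; the added 1 makes [K] positive, so that
     [K] times an infinite value stays infinite. *)
  pose K := 2 * N ^+ 2 + 1.
  have K0 : 0 < K by rewrite /K; have := sqr_ge0 N; lra.
  have pK x : sqn (p x) <= K.
    have [a b] := HN x; rewrite /sqn /K -[complex.Re _ ^+ 2]real_normK ?num_real //.
    rewrite -[complex.Im _ ^+ 2]real_normK ?num_real //.
    have := normr_ge0 (complex.Re (p x)); have := normr_ge0 (complex.Im (p x)).
    by nra.
  apply: (@le_lt_trans _ _ (\int[lam]_x (K%:E * sqnorm_div f T x))%E).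
    apply: ge0_le_integral => //.
    - by move=> x _; exact: sqnorm_div_ge0.
    - exact: measurable_sqnorm_div.
    - by apply: measurable_funeM; exact: measurable_sqnorm_div.
    move=> x _; have [Tx|Tx] := eqVneq (T x) 0.
      by rewrite !sqnorm_div_00 ?Tx ?mul0r ?mule0.
    have [fx|fx] := eqVneq (f x) 0.
      by rewrite (@sqnorm_div_n0 _ _ _ T) // gt0_muley ?leey // lte_fin.
    rewrite !sqnorm_div_pos // -EFinM lee_fin sqnM mulrA [K * _]mulrC.
    by rewrite ler_wpM2r ?invr_ge0 // ler_wpM2l ?sqn_ge0.
  rewrite ge0_integralZl //.
  - by rewrite lte_mul_pinfty // ?lee_fin ltW.
  - exact: measurable_sqnorm_div.
  - by move=> x _; exact: sqnorm_div_ge0.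
  - by rewrite lee_fin ltW.
rewrite L2inv_norm_lt //; apply: le_lt_trans hp.
have bd : bmeas (fun x => F x - T x * p x) by exact: bmeasB.
have [mdr mdi _] := bd.
apply: ae_ge0_le_integral => //.
- by move=> x _; exact: sqnorm_div_ge0.
- exact: measurable_sqnorm_div.
- by move=> x _; rewrite lee_fin mulr_ge0 // sqn_ge0.
- apply/measurable_EFinP; apply: measurable_funM => //.
  have [pr pi _] := bp; apply: measurable_sqn_comp.
    by under eq_fun do rewrite ReD ReN; exact: measurable_funB.
  by under eq_fun do rewrite ImD ImN; exact: measurable_funB.
apply: filterS fae => x [Tx fx] _.
rewrite sqnorm_div_pos; last exact/eqP.
rewrite lee_fin /w mulrA -sqnM mulrBl /h divfK; last exact/eqP.
by rewrite [p x * _]mulrC.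
Qed.

Let m1 : measurable_fun setT (fun _ : X => 1 : R).
Proof. exact: measurable_cst. Qed.

Let one01 (x : X) : 0 <= (1 : R) <= 1.
Proof. by rewrite ler01 lexx. Qed.

(** The second factor has only the frequencies k + e, all outside [A]. *)
Lemma ip1_exp_span_disjoint (A : set Z) (u : X -> R[i]) (s : seq Z)
    (c : Z -> R[i]) (e : Z) :
  exp_span A u -> (forall k, k \in s -> ~ A (k + e)) ->
  ip1 u (fun x => (\sum_(k <- s) c k * cexp k x) * cexp e x) = 0.
Proof.
move=> su sA; have bu := bmeas_exp_span su.
rewrite (_ : (fun x => _) = fun x => \sum_(k <- s) c k * cexp (k + e) x); last first.
  by apply/funext => x; rewrite mulr_suml; apply: eq_bigr => k _; rewrite cexpD mulrA.
rewrite ip_sumr // => [|k]; last exact: bmeas_cexp.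
rewrite big1_seq // => k /andP[_ ks].
case: su => m [b [a [Ab ->]]].
have be e' : bmeas (cexp e' : X -> R[i]) by exact: bmeas_cexp.
rewrite ip_sum //.
rewrite big1 ?mulr0 // => l _; rewrite ip1_cexp.
case: eqVneq => [E|_]; last by rewrite mulr0.
by case: (sA k ks); rewrite -E.
Qed.

(* u is the projection of e onto the span of the exponentials in A, and T e / f
   is orthogonal to that span: so |u| is at most the distance from e to T e / f. *)
Lemma nrm2_projection_le (A : set Z) (e : Z) (u T : X -> R[i]) (r : R) :
  exp_span A u ->
  (forall e', A e' -> ip f (fun x => cexp e x - u x) (cexp e') = 0) ->
  trig_poly T -> ip1 u (fun x => T x * cexp e x) = 0 ->
  (\int[lam]_x sqnorm_div f (fun y => (F y - T y)%R) x < r%:E)%E ->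
  nrm2 f u <= r.
Proof.
move=> su ou tT oT; have bu := bmeas_exp_span su; have bT := bmeas_trig tT.
have be := @bmeas_cexp R d e; have bq := bmeasB be bu.
have bTe := bmeasM bT be; have bFT := bmeasB bF bT.
have [mr mi _] := bFT.
have fu : ip f u (cexp e) = (nrm2 f u)%:C.
  have q0 := ip_exp_span0 f_meas f01 bq ou su.
  have e1 : ip f (cexp e) u = (nrm2 f u)%:C.
    rewrite -ip_nrm2 //; apply/eqP; rewrite -subr_eq0; apply/eqP.
    by rewrite -ipB.
  by rewrite (ip_conj f_meas f01 be bu) e1 conjc_real.
(* Its integral is the weighted product of [u] with [e] minus the unweighted product of [u] with
   [T e]. The first is [nrm2 f u], as e - u is orthogonal to u, and the second is 0. *)
pose z x := u x * (cexp e x)^*%C * (F x - T x)^*%C.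
have bz : bmeas z.
  by apply: bmeasM; [apply: bmeasM => //|]; exact: bmeas_conj.
have cz : torus_cintegral z = (nrm2 f u)%:C.
  rewrite -fu -[RHS]subr0 -oT /ip -cintB; first last.
  - by apply: bmeasM; [exact: bmeas_cst|apply: bmeasM => //; exact: bmeas_conj].
  - by apply: bmeasM => //; apply: bmeasM => //; exact: bmeas_conj.
  congr torus_cintegral; apply/funext => x; rewrite /z conjcM.
  have -> : (F x - T x)^*%C = F x - (T x)^*%C by rewrite rmorphB /= oppr0.
  by rewrite mul1r; ring.
have [iz _] := bmeas_integrable bz.
set J := (\int[lam]_x _)%E => Jr.
have J0 : (0 <= J)%E by apply: integral_ge0 => x _; exact: sqnorm_div_ge0.
have [D ED] : exists D : R, J = D%:E.
  by exists (fine J); rewrite fineK // ge0_fin_numE // (lt_trans Jr) // ltry.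
move: Jr; rewrite ED lte_fin => Dr.
have iS : lam.-integrable setT (sqnorm_div f (fun y => (F y - T y)%R)).
  by apply/(integrable_sqnorm_div f_meas f01 mr mi); rewrite -/J ED ltry.
have bfu : bmeas (fun x => F x * (u x * (u x)^*%C)).
  by apply: bmeasM => //; apply: bmeasM => //; exact: bmeas_conj.
have ifu : lam.-integrable setT (EFin \o (fun x => f x * sqn (u x))).
  have [+ _] := bmeas_integrable bfu; apply: eq_integrable => // x _.
  by rewrite /= mulc_conj /= mul0r subr0.
have E1 : (\int[lam]_x (complex.Re (z x))%:E = (nrm2 f u)%:E)%E.
  rewrite -[LHS]fineK; last exact: integrable_fin_num iz.
  by congr EFin; have := congr1 (@complex.Re R) cz.
have E2 : (\int[lam]_x (f x * sqn (u x))%:E = (nrm2 f u)%:E)%E.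
  by rewrite -[LHS]fineK //; exact: integrable_fin_num ifu.
have i1 : lam.-integrable setT (fun x => (2^-1)%:E * (f x * sqn (u x))%:E)%E.
  exact: integrableZl.
have i2 : lam.-integrable setT
    (fun x => (2^-1)%:E * sqnorm_div f (fun y => (F y - T y)%R) x)%E.
  exact: integrableZl.
(* Pointwise, Re z <= (f |u|^2 + |f - T|^2 / f) / 2; integrating, half of [nrm2 f u] is absorbed on
   the left. *)
have : ((nrm2 f u)%:E <= (2^-1)%:E * (nrm2 f u)%:E + (2^-1)%:E * D%:E)%E.
  rewrite -ED /J -{2}E2 -E1 -integralZl // -integralZl // -integralD //.
  apply: le_integral => //; first exact: integrableD.
  move=> x _; have sz : sqn (z x) = sqn (u x) * sqn (F x - T x).
    by rewrite /z !sqnM !sqn_conjc sqn_cexp mulr1.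
  have rz : complex.Re (z x) ^+ 2 <= sqn (u x) * sqn (F x - T x).
    by rewrite -sz lerDl sqr_ge0.
  have u0 := sqn_ge0 (u x); have /andP[f0 _] := f01 x.
  have [FT|FT] := eqVneq (F x - T x) 0.
    rewrite sqnorm_div_00 // mule0 adde0 -EFinM lee_fin.
    move: rz; rewrite FT sqn0 mulr0 => rz.
    apply: (@le_trans _ _ 0); last by rewrite mulr_ge0 // mulr_ge0.
    by have := sqr_ge0 (complex.Re (z x)); nra.
  have [fx|fx] := eqVneq (f x) 0.
    rewrite sqnorm_div_n0 // gt0_muley ?lte_fin // addey ?leey //.
  rewrite sqnorm_div_pos // -!EFinM -EFinD lee_fin.
  set W := sqn (F x - T x) / f x.
  have W0 : 0 <= W by rewrite divr_ge0 // sqn_ge0.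
  have WE : sqn (F x - T x) = W * f x by rewrite /W divfK.
  move: rz; rewrite WE; move: (complex.Re (z x)) (sqn (u x)) u0 => a b b0 rz.
  have V0 : 0 <= f x * b by rewrite mulr_ge0.
  have H : a ^+ 2 <= (f x * b) * W by nra.
  by have := sqr_ge0 (f x * b - W); nra.
by rewrite -!EFinM -EFinD lee_fin; lra.
Qed.

(** Conditioning changes the (i, j) entry of the matrix by the product of [u i] with an exponential,
    hence by a squared amount at most [r], uniformly in [k]. Continuity of the determinant turns
    this into a bound that passes through both limits. *)
Lemma closure_plus_same (P Q : probability (config d) R) :
  determinantal f P -> plus_limit P Q -> closure F -> same_law Q P.
Proof.
move=> hP [mu [hmu wmu]] cF; apply: same_law_ones => s us.
have fQ (Q' : probability (config d) R) : (Q' (ones s) = (fine (Q' (ones s)))%:E)%E.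
  by rewrite fineK // fin_num_measure //; exact: measurable_ones.
rewrite (fQ Q) (fQ P); congr EFin.
apply/eqP; rewrite -subr_eq0 -normr_le0; apply/ler_addgt0Pl => D D0; rewrite addr0.
pose a (i : 'I_(size s)) : Z := tnth (in_tuple s) i.
have ia : injective a by apply/tuple_uniqP.
have Ea : ones (codom a) = ones s.
  apply: ones_eqi => e; apply/codomP/idP => [[i ->]|es]; first exact: mem_tnth.
  by have /tnthP[i ->] : e \in in_tuple s by []; exists i.
have PE := probability_ones_det hP ia; rewrite Ea in PE.
pose M0 := \matrix_(i < size s, j < size s) ip f (cexp (a i)) (cexp (a j)).
have D2 : 0 < D ^+ 2 by rewrite exprn_gt0.
have [r r0 Hr] := det_continuous M0 D2.
have [T [tT LT HT]] := closure_exists_lt cF r0.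
have [sT [c ET]] := tT.
(* Once [box n] contains the translates k + e, the product of [T] with each exponential of [s] has
   no frequency in any collar. *)
have [N hN] := box_cover (s ++ [seq k + e | k <- sT, e <- s]).
have ais i : a i \in s by exact: mem_tnth.
suff H n : (N <= n)%N -> `|fine (mu n (ones s)) - fine (P (ones s))| <= D.
  apply: (cvg_dist_le (weak_star_ones (s := s) wmu)).
  by exists N.
move=> Nn.
have sn e : e \in s -> box n e.
  by move=> es; apply: box_le Nn _ (hN _ _); rewrite mem_cat es.
apply: (cvg_dist_le (plus_box_ones (hmu n) sn)).
apply: filterS (plus_box_pos (hmu n)) => k Pk.
have an i : box n (a i) by exact: sn.
have [u [su ou du]] := collar_det f_meas f01 hP ia an Pk.
move: du; rewrite /collar_prob Ea; set M := (\matrix_(i, j) _); set y := _ / _ => du.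
have bu i : bmeas (u i) := bmeas_exp_span (su i).
have : sqn (\det M - \det M0) <= D ^+ 2.
  apply: Hr => i j; rewrite !mxE.
  have be i' : bmeas (cexp (a i') : X -> R[i]) by exact: bmeas_cexp.
  rewrite ipB // addrAC subrr add0r sqnN.
  apply: (le_trans (ip_cauchy_schwarz f_meas f01 (bu i) (be j))).
  have nu : nrm2 f (u i) <= r.
    apply: (nrm2_projection_le (su i) (ou i) tT _ HT).
    rewrite ET; apply: ip1_exp_span_disjoint (su i) _ => k' k's [_]; apply.
    apply: box_le Nn _ (hN _ _); rewrite mem_cat; apply/orP; right.
    by apply/allpairsP; exists (k', a i); split=> //; exact: ais.
  apply: le_trans nu; rewrite ler_piMr ?nrm2_cexp_le1 //; exact: nrm2_ge0.
rewrite -du -PE -rmorphB sqn_real -[_ ^+ 2 <= _]/(_ ^+ 2 <= D ^+ 2).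
rewrite -real_normK ?num_real // ler_pXn2r // nnegrE ?normr_ge0 //.
exact: ltW.
Qed.

Lemma no_quotient_plus_dirac (P Q : probability (config d) R) :
  determinantal f P -> plus_limit P Q ->
  ~ (exists T : X -> R[i], [/\ trig_poly T, T <> (fun=> 0) &
      lam.-integrable setT (sqnorm_div f T)]) ->
  same_law Q (dirac (all_zero d)).
Proof.
move=> hP [mu [hmu wmu]] nT; apply: same_law_dirac0 => e.
have [N hN] := box_exists e.
have m0 n : (N <= n)%N -> fine (mu n (ones [:: e])) = 0.
  move=> Nn; apply: contrapT => /eqP h; apply: nT.
  apply: (nonzero_plus_quotient f_meas f01 hP (hmu n) _ h).
  exact: box_le hN.
have : `|fine (Q (ones [:: e])) - 0| <= 0.
  apply: (cvg_dist_le (weak_star_ones (s := [:: e]) wmu)).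
  by exists N => // n /= /m0 ->; rewrite subrr normr0.
rewrite subr0 normr_le0 => /eqP h; rewrite -[LHS]fineK ?h //.
by rewrite fin_num_measure //; exact: measurable_ones.
Qed.

(** The probability of a 1 at the origin is the integral of [f]. *)
Lemma determinantal_not_dirac (P : probability (config d) R) :
  determinantal f P -> ~ {ae lam, forall x, f x = 0} ->
  ~ same_law P (dirac (all_zero d)).
Proof.
move=> hP fn0 h; apply: fn0.
have ms := @measurable_ones d [:: 0].
have := h _ ms.
rewrite -[RHS]/(\1_(ones [:: 0]) (all_zero d))%:E indicE memNset; last first.
  by move=> /(_ 0); rewrite /= inE eqxx => /(_ isT).
move=> P0.
have := @probability_ones_det _ _ _ _ hP 1 (fun=> 0) _.
rewrite (_ : codom _ = [:: 0]); last first.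
  by rewrite /codom /image_mem enum_ordSl /= [enum _]size0nil // size_enum_ord.
move=> /(_ _)/wrap[|]; first by move=> i j _; rewrite !ord1.
rewrite P0 /= det_mx11 mxE ip_nrm2 //; last exact: bmeas_cexp.
move=> /complexI/esym; rewrite /nrm2.
under eq_Rintegral => x _ do rewrite sqn_cexp mulr1.
rewrite /Rintegral => f0.
have : (\int[lam]_x `|(f x)%:E| = 0)%E.
  under eq_integral => x _.
    rewrite gee0_abs; last by rewrite lee_fin; case/andP: (f01 x).
    over.
  rewrite -[LHS]fineK ?f0 // ge0_fin_numE ?integral_f_fin //.
  by apply: integral_ge0 => x _; rewrite lee_fin; case/andP: (f01 x).
move/(ae_eq_integral_abs _ measurableT); move=> /(_ _)/wrap[|h'].
  exact/measurable_EFinP.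
by apply: filterS h' => x /(_ I)[].
Qed.

End equivalences.

Theorem theorem7p7 (R : realType) (d : nat) (hd : (1 <= d)%N)
    (f : d.-tuple R -> R)
    (f_per : periodicZ f)
    (f_meas : measurable_fun setT f)
    (f01 : forall x, 0 <= f x <= 1)
    (f_not0 : ~ {ae torus_measure d, forall x, f x = 0})
    (f_not1 : ~ {ae torus_measure d, forall x, f x = 1})
    (P Pplus : probability (config d) R)
    (hP : determinantal f P)
    (hPplus : plus_limit P Pplus) :
  let i := same_law Pplus P in
  let ii := L2inv_closure f (trig_poly (d := d) `&` L2inv f)
              (fun x => (f x)%:C) in
  let iii := exists T : d.-tuple R -> R[i],
               [/\ trig_poly T, T <> (fun=> 0) &
                   (torus_measure d).-integrable setT (sqnorm_div f T)] in
  (i <-> ii) /\ (ii <-> iii) /\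
  (~ i -> same_law Pplus (dirac (all_zero d))).
Proof.
move=> i ii iii.
have ii_iii : ii -> iii := closure_quotient f_meas f01 f_not0.
have iii_ii : iii -> ii.
  by move=> [T [tT T0 iT]]; exact: (quotient_closure f_per f_meas f01 tT T0 iT).
have ii_i : ii -> i := closure_plus_same f_meas f01 hP hPplus.
have niii_dirac : ~ iii -> same_law Pplus (dirac (all_zero d)) :=
  no_quotient_plus_dirac f_meas f01 hP hPplus.
(* If (iii) fails, the limit law is the point mass, which [P] is not. *)
have i_iii : i -> iii.
  move=> hi; apply: contrapT => /niii_dirac hdirac.
  apply: (determinantal_not_dirac f_meas f01 hP f_not0) => A mA.
  by rewrite -hi // hdirac.
split; first by split=> [/i_iii/iii_ii|].
split=> // ni; apply: niii_dirac => /iii_ii/ii_i; exact: ni.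
Qed.
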